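(* For any $0<\delta\le 1$, on biconnected networks with $n$ nodes whose only whiteboard is located at the homebase, there exists a protocol for the rB-hole Search problem with either of the following resource requirements: (1) $O(1)$ agents and $O(s(\pi)+\Delta n+r(\pi)^2)$ moves, where $\Delta=\lceil\log_{1-p}\delta\rceil\simeq\frac1p\log\frac1\delta$; (2) $\lceil\log r(\pi)+2\rceil$ agents and $O(s(\pi)+\Delta n+r(\pi)\log r(\pi))$ moves, where $\Delta=\left\lceil\log_{1-p}\!\left(\frac{\delta}{\log r(\pi)+1}\right)\right\rceil\simeq\frac1p\log\left(\frac{\log r(\pi)+1}{\delta}\right)$. In each case at least one agent survives, and the protocol fails to indicate the rB-hole with probability less than $\delta$.
   Context: Network and agents. The network is a biconnected undirected graph $G$ with $n$ nodes, which may be anonymous. Agents are computational entities with bounded local memory that move along links between adjacent nodes and run a common protocol. All agents start at a common safe node $h$, the homebase. A whiteboard is a shared memory of $O(\log n)$ bits that agents at its node can read and write in mutual exclusion; here the only whiteboard is at the homebase and it is the only means of communication. Agents are asynchronous: each action (computation step or move on a link) takes finite but unpredictable time, with no bound. Numbers of moves and agents are worst-case totals. rB-hole. An rB-hole is located at a node and has a killing probability: when an agent moves from a safe node to the rB-hole, a biased coin is flipped and the agent is killed with that probability, leaving no observable trace; if it survives it is safe while at the node; when it moves from the rB-hole to a safe node, another coin is flipped and it is killed with the same probability, otherwise it leaves safely. Problem. It is given that exactly one node (different from $h$) contains the rB-hole. The rB-hole Search problem asks for a protocol coordinating the agents so that after a finite number of moves at least one agent survives and reports the location of the rB-hole; the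 output may be wrong with a bounded error probability. Every agent knows the full topology of the graph and knows a lower bound $p$, $0<p\le 1$, on the killing probability. For $p=1$, $\Delta$ is read as $0$. Traversal pairs. Let $v_1,\ldots,v_n$ be a total ordering of the nodes of $G$. A $u$-$v$ traversal pair with respect to this ordering is a pair $\pi=(\pi_l,\pi_r)$ of paths (walks) in $G$ starting from $u=v_1$ and $v=v_n$ respectively and exploring the nodes (i.e. visiting them for the first time) in the order $v_1,\ldots,v_n$ and $v_n,\ldots,v_1$ respectively. Here $\pi$ is a fixed $h$-$v$ traversal pair shared by all agents, where $h$ is the homebase and $v$ one of its neighbours. Its size is $s(\pi)=\max\{|\pi_l|,|\pi_r|\}$, where $|\gamma|$ is the number of edges of $\gamma$. Its radius is $r(\pi)=\max_{w}\max\{r_u(w),r_v(w)\}$, where $r_u(w)$ (resp. $r_v(w)$) is the length of a shortest path that starts from the homebase and reaches $w$ crossing (apart from the homebase) only nodes that precede (resp. follow) $w$ in the ordering. For nodes $v_i,v_j$, $\pi_l[v_i,v_j]$ (resp. $\pi_r[v_i,v_j]$) is the subpath of $\pi_l$ (resp. $\pi_r$) connecting the first occurrences of $v_i$ and $v_j$, and $w([v_i,v_j])=|\pi_l[v_i,v_j]|+|\pi_r[v_i,v_j]|$. It is assumed that $w([v_i,v_{i+1}])\le 4r(\pi)$ for every $i$. *)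

(* Defs.v *)
From mathcomp Require Import all_boot all_order all_algebra.
From mathcomp Require Import boolp reals exp.
Set Implicit Arguments.
Unset Strict Implicit.
Unset Printing Implicit Defensive.
Import Order.TTheory GRing.Theory Num.Theory.

Local Open Scope nat_scope.

Section Network.
Variables (T : finType) (e : rel T).

Definition connected := forall x y : T, connect e x y.

Definition remove_node (z : T) : rel T :=
  [rel x y | [&& e x y, x != z & y != z]].

(* A single edge counts as biconnected. *)
Definition biconnected :=
  connected /\
  forall z x y : T, x != z -> y != z -> connect (remove_node z) x y.

Definition network := [/\ symmetric e, irreflexive e & biconnected].

(* Length of a shortest path from x to y whose nodes other than y satisfy A
   (and #|T| if there is none). *)
Definition dist_through (A : pred T) (x y : T) : nat :=
  find (fun d => [exists q : d.-tuple T,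
                    [&& path e x q, last x q == y & all A (belast x q)]])
       (iota 0 #|T|).

(* Walks are sequences of nodes; |gamma| is the number of edges. *)
Definition walk_length (w : seq T) : nat := (size w).-1.

(* vs is the list v_1, ..., v_n, and (wl, wr) is the pair (pi_l, pi_r).
   [index x w] is the position of the first occurrence of x in w, i.e. the time
   at which the walk w explores x. *)
Record traversal_pair (u v : T) (vs wl wr : seq T) : Prop := {
  order_uniq : uniq vs;
  order_all : forall x, x \in vs;
  order_first : ohead vs = Some u;
  order_last : last u vs = v;
  left_walk : sorted e wl;
  left_start : ohead wl = Some u;
  left_all : forall x, x \in wl;
  left_order : forall x y, index x vs < index y vs -> index x wl < index y wl;
  right_walk : sorted e wr;
  right_start : ohead wr = Some v;
  right_all : forall x, x \in wr;
  right_order : forall x y, index x vs < index y vs -> index y wr < index x wr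
}.

Definition tp_size (wl wr : seq T) : nat :=
  maxn (walk_length wl) (walk_length wr).

Section Radius.
Variables (h : T) (vs : seq T).

Definition r_left (w : T) : nat :=
  dist_through (fun x => (x == h) || (index x vs < index w vs)) h w.

Definition r_right (w : T) : nat :=
  dist_through (fun x => (x == h) || (index w vs < index x vs)) h w.

Definition tp_radius : nat := \max_(w : T) maxn (r_left w) (r_right w).

End Radius.

Definition tp_weight (wl wr : seq T) (x y : T) : nat :=
  `|index x wl - index y wl|%N + `|index x wr - index y wr|%N.

(* w([v_i, v_(i+1)]) <= 4 r(pi) for every i (indices start at 0 here). *)
Definition light_steps (h : T) (vs wl wr : seq T) : Prop :=
  forall i, i.+1 < #|T| ->
    tp_weight wl wr (nth h vs i) (nth h vs i.+1) <= 4 * tp_radius h vs.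

End Network.

Section Model.
Variables (T : finType) (e : rel T) (h : T).

Inductive decision (M : Type) : Type :=
  | Stay of M
  | Move of M & T
  | Report of T.

(* The common protocol.  A computation step at the homebase h reads and rewrites
   the whiteboard atomically; elsewhere it depends on the local memory and on the
   current node only, which the agent knows since it has the map and started
   at h.  The local memory is finite, but its size is not otherwise bounded. *)
Record protocol := Protocol {
  memory : finType;
  board : finType;
  memory0 : memory;
  board0 : board;
  home_step : memory -> board -> board * decision memory;
  away_step : memory -> T -> decision memory
}.

(* [Transit m x y]: the agent is on the link from x to y, with memory m. *)
Inductive status (M : Type) : Type :=
  | At of M & T
  | Transit of M & T & T
  | Reported of T
  | Killed.

Section Execution.
Variables (k : nat) (P : protocol).

(* [flips x i] is the number of coins flipped so far for agent i;
   [moves x] is the total number of moves started so far by all the agents. *)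
Record config := Config {
  whiteboard : board P;
  agent : 'I_k -> status (memory P);
  flips : 'I_k -> nat;
  moves : nat
}.

Definition config0 : config :=
  Config (board0 P) (fun _ => At (memory0 P) h) (fun _ => 0) 0.

Definition upd (A : Type) (f : 'I_k -> A) (i : 'I_k) (a : A) : 'I_k -> A :=
  fun j => if j == i then a else f j.

(* [c i j] is the result of the j-th coin flipped for agent i; true kills. *)
Definition coins := 'I_k -> nat -> bool.

(* Agent i performs its next action when the rB-hole is at node b.  An agent that
   decides to move first enters the link, and reaches the other end in a
   later action: the adversary may delay it in between.  Every traversal of a
   link incident to b, in either direction, costs one coin. *)
Definition step (b : T) (c : coins) (i : 'I_k) (x : config) : config :=
  match agent x i with
  | At m y =>
      let: (w, d) :=
        if y == h then home_step m (whiteboard x)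
        else (whiteboard x, away_step m y) in
      match d with
      | Stay m' => Config w (upd (agent x) i (At m' y)) (flips x) (moves x)
      | Move m' z =>
          if e y z then
            Config w (upd (agent x) i (Transit m' y z)) (flips x) (moves x).+1
          else Config w (upd (agent x) i (At m' y)) (flips x) (moves x)
      | Report z =>
          Config w (upd (agent x) i (Reported _ z)) (flips x) (moves x)
      end
  | Transit m y z =>
      if (y == b) || (z == b) then
        Config (whiteboard x)
          (upd (agent x) i (if c i (flips x i) then Killed _ else At m z))
          (upd (flips x) i (flips x i).+1) (moves x)
      else
        Config (whiteboard x) (upd (agent x) i (At m z)) (flips x) (moves x)
  | Reported _ | Killed => x
  end.

(* An adaptive adversary: it picks the agent that acts next, given the current
   configuration and the past ones (latest first). *)
Definition scheduler := config -> seq config -> 'I_k.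

Fixpoint history (b : T) (sch : scheduler) (c : coins) (t : nat) :
    config * seq config :=
  if t is t'.+1 then
    let: (x, past) := history b sch c t' in
    (step b c (sch x past) x, x :: past)
  else (config0, [::]).

Definition run b sch c t : config := (history b sch c t).1.

Definition scheduled b (sch : scheduler) c t : 'I_k :=
  sch (history b sch c t).1 (history b sch c t).2.

Definition halted (s : status (memory P)) : Prop :=
  match s with Reported _ | Killed => True | _ => False end.

Definition correct b sch c : Prop :=
  (exists t i, agent (run b sch c t) i = Reported _ b) /\
  (forall t i z, agent (run b sch c t) i = Reported _ z -> z = b).

Section Probability.
Variables (R : realType) (q : R).

(* If the killing probability q is 1, no agent survives a coin. *)
Definition possible (c : coins) : Prop :=
  forall i j, c i j = false -> (q < 1)%R.

(* Each action takes finite time. *)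
Definition fair b (sch : scheduler) : Prop :=
  forall c, possible c -> forall (i : 'I_k) (t : nat),
  exists2 t', t <= t' &
    scheduled b sch c t' = i \/ halted (agent (run b sch c t') i).

Definition coins_of N (f : {ffun 'I_k * 'I_N -> bool}) : coins :=
  fun i j => if insub j is Some j' then f (i, j') else true.

(* The probability of E when the first N coins of each agent are independent
   and each of them kills with probability q. *)
Definition coin_prob (N : nat) (E : coins -> Prop) : R :=
  (\sum_(f : {ffun 'I_k * 'I_N -> bool} | `[< E (coins_of f) >])
     \prod_(a : 'I_k * 'I_N) (if f a then q else 1 - q))%R.

Definition flips_bound b sch (N : nat) : Prop :=
  forall c, possible c -> forall t i, flips (run b sch c t) i <= N.

End Probability.

(* P, run by k agents, solves rB-hole Search with at most B moves in total, at
   least one surviving agent, and failure probability less than delta.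
   - Agents that report or are killed stay in that state, so an agent in state
     [Reported] has survived.
   - At most one coin is flipped per move, so every N >= B satisfies
     [flips_bound]; under that hypothesis the first N coins determine the
     execution, and the probability does not depend on N. *)
Definition solves (R : realType) (p delta B : R) : Prop :=
  forall (b : T) (q : R) (sch : scheduler),
    b != h -> (p <= q <= 1)%R -> fair q b sch ->
  [/\ forall c, possible q c -> forall t, ((moves (run b sch c t))%:R <= B)%R,
      forall c, possible q c ->
        exists t i z, agent (run b sch c t) i = Reported _ z
    & forall N, flips_bound q b sch N ->
        (coin_prob q N (fun c => ~ correct b sch c) < delta)%R].

End Execution.

(* O(log n) bits, i.e. at most n ^ cw = 2 ^ (cw * log2 n) values. *)
Definition small_board (P : protocol) (cw : nat) : Prop :=
  #|board P| <= #|T| ^ cw.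

End Model.

Local Open Scope ring_scope.

Definition log2 (R : realType) (x : R) : R := ln x / ln 2.

Definition nat_ceil (R : realType) (x : R) : nat := `|Num.ceil x|%N.

(* The ceiling of log_(1-p) x, for 0 < p <= 1 and 0 < x <= 1. *)
Definition Delta (R : realType) (p x : R) : nat :=
  if p == 1 then 0%N else nat_ceil (ln x / ln (1 - p)).

(* Main.v *)
(* Agents take disjoint intervals of the order v_1, ..., v_n from its two ends and
   explore them along closed walks from h, through nodes explored before on the same
   side, crossing each new node 2 K + 1 times with K proportional to Delta; hence
   exploring the rB-hole kills an agent except with probability at most
   (1 - p) ^ (2 K + 1).  Of two simultaneous explorers, one on each side, at most one
   can meet the hole, so one interval is always completed; once only one interval is
   left, it is taken back from its explorer, late or dead, and divided further.
   Intervals have size at most 2 ^ J, with 2 ^ J >= r, and weight at most r.  When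
   taken back, an interval is halved in part (2), and cut into single nodes in
   part (1); so at most log r, resp. one, agents are lost before the last interval
   is a single node, where the hole must be.  A potential of the whiteboard pays for
   all the walks, including those of agents whose interval was taken back.
   For r = 1 in part (2), where a union bound over the agents would be too weak, only
   the agent that flips the first coin ever meets the hole, and it does not depend
   on the coins. *)
Require Import Defs.
From mathcomp Require Import all_boot all_order all_algebra.
From mathcomp Require Import boolp reals exp.
From mathcomp Require Import zify ring lra.
Set Implicit Arguments.
Unset Strict Implicit.
Unset Printing Implicit Defensive.
Local Open Scope nat_scope.

(** Greedy choice of a chunk size: [P 1] makes the range of the maximum nonempty, so the maximum is
    itself a member; the last clause is the form of maximality used by the potential argument. *)
Lemma bigmax_ord_spec (m : nat) (P : pred nat) (s := \max_(i < m.+1 | P i) i) :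
  0 < m -> P 1 ->
  [/\ 0 < s, s <= m, P s & s < m -> ~~ P s.+1].
Proof.
move=> m_gt0 P1.
have s_gt0 : 0 < s.
  exact: (@leq_bigmax_cond _ (fun i : 'I_m.+1 => P i) (fun i => i : nat)
            (Ordinal (m_gt0 : 1 < m.+1)) P1).
have [i Pi si] : exists2 i : 'I_m.+1, P i & s = i.
  case: (@eq_bigmax_cond _ (fun i : 'I_m.+1 => P i) (fun i => i : nat)).
    by apply/card_gt0P; exists (Ordinal (m_gt0 : 1 < m.+1)).
  by move=> i Pi si; exists i.
split=> //; rewrite ?si //; first by rewrite -ltnS.
rewrite -si => s_lt_m; apply/negP => PS.
have := @leq_bigmax_cond _ (fun i : 'I_m.+1 => P i) (fun i => i : nat)
  (Ordinal (s_lt_m : s.+1 < m.+1)) PS.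
by rewrite -/s ltnn.
Qed.

(* The nodes before [lo] and from [hi] on have been explored, the intervals
   [lo, la) and [rb, hi) are assigned to an agent each (if nonempty), and nobody
   has been sent to [la, rb). *)
Record bd := Bd { lo : nat; la : nat; rb : nat; hi : nat; lev : nat }.

(* A side ([true] for left) and the bounds x, y of the interval [x, y). *)
Definition mission := (bool * nat * nat)%type.

Inductive verdict := Wait | Located | Send of bd & mission.

Definition lmission (w : bd) : mission := (true, lo w, la w).
Definition rmission (w : bd) : mission := (false, rb w, hi w).
Definition lbusy (w : bd) := lo w < la w.
Definition rbusy (w : bd) := rb w < hi w.

Definition finish (m : mission) (w : bd) : bd :=
  if m == lmission w then Bd (la w) (la w) (rb w) (hi w) (lev w)
  else if m == rmission w then Bd (lo w) (la w) (rb w) (rb w) (lev w)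
  else w.

(** * Allocation of intervals on the whiteboard, and the potential that pays for it *)

Section Dispatch.
Variables (F : nat -> nat) (nxt : nat -> nat) (r : nat).

(** [F] accumulates weight along the order, so a chunk has at most [2 ^ j] nodes and weight at most
    [r]. Being greedy, it exhausts one of the two bounds or the whole interval. *)
Definition lchunk (j a b : nat) : nat :=
  \max_(s < (b - a).+1 | (s <= 2 ^ j) && (F (a + s).-1 <= F a + r)) s.

Definition rchunk (j a b : nat) : nat :=
  \max_(s < (b - a).+1 | (s <= 2 ^ j) && (F b.-1 <= F (b - s) + r)) s.

(* An interval whose agent is late, perhaps forever, is taken back. *)
Definition reclaim (w : bd) : bd :=
  if la w == rb w then Bd (lo w) (lo w) (hi w) (hi w) (nxt (lev w)) else w.

(** The second branch presupposes a free right side. This holds because [dispatch] waits when both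
    sides are busy and [reclaim] frees both. *)
Definition assign (w : bd) : bd * mission :=
  if la w == lo w then
    let y := la w + lchunk (lev w) (la w) (rb w) in
    (Bd (lo w) y (rb w) (hi w) (lev w), (true, lo w, y))
  else
    let x := rb w - rchunk (lev w) (la w) (rb w) in
    (Bd (lo w) (la w) x (hi w) (lev w), (false, x, hi w)).

Definition dispatch (w : bd) : verdict :=
  if hi w <= (lo w).+1 then Located
  else if lbusy w && rbusy w then Wait
  else let (w', m) := assign (reclaim w) in Send w' m.

Variables (n J K : nat) (Fut : nat -> nat).
Hypothesis r_gt0 : 0 < r.
Hypothesis F_mono : forall i, i.+1 < n -> F i < F i.+1.
Hypothesis r_le_J : r <= 2 ^ J.
Hypothesis nxt_lt : forall j, 0 < j -> nxt j < j.
(** [Fut j] is the budget for all levels below [j]. An interval of at most [2 ^ j] nodes that is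
    taken back yields at most [2 ^ (j - nxt j)] chunks, charged [4 * r] each, and its nodes cost
    [2 * K] each. *)
Hypothesis Fut_nxt : forall j, 0 < j -> j <= J ->
  4 * r * 2 ^ (j - nxt j) + 2 * K * 2 ^ j + Fut (nxt j) <= Fut j.

(** [ok_weight] is claimed only below the top level: there [lo, hi) lies inside a chunk that was
    once assigned to a single agent, hence is light as a whole. *)
Record okb (w : bd) : Prop := {
  ok_lo : 0 < lo w;
  ok_la : lo w <= la w;
  ok_rb : la w <= rb w;
  ok_hi : rb w <= hi w;
  ok_n : hi w <= n;
  ok_lev : lev w <= J;
  ok_lsize : la w - lo w <= 2 ^ lev w;
  ok_rsize : hi w - rb w <= 2 ^ lev w;
  ok_lweight : lbusy w -> F (la w).-1 <= F (lo w) + r;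
  ok_rweight : rbusy w -> F (hi w).-1 <= F (rb w) + r;
  ok_weight : lev w < J -> lo w < hi w -> F (hi w).-1 <= F (lo w) + r
}.

(** Budget for handing out [a, b). At the top level a chunk that leaves a remainder lowers the
    remaining weight by at least [r], which releases [4 * r]; the summand [r] pays for the last
    chunk. Below the top level weight never limits a chunk, so [4 * r] is charged per chunk, and the
    quotient is a rounded-up division. *)
Definition middle (j a b : nat) : nat :=
  if a < b then
    (if j == J then 4 * (F b.-1 - F a + r)
     else 4 * r * ((b - a + (2 ^ j).-1) %/ 2 ^ j)) + 2 * K * (b - a)
  else 0.

Definition potential (w : bd) : nat :=
  middle (lev w) (la w) (rb w) + Fut (lev w).

(** At most [r] to reach the interval, [r] to traverse it and [r] to return, plus [2 * K] moves of
    dwelling at each of its nodes. *)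
Definition cost (m : mission) : nat := 3 * r + 2 * K * (m.2 - m.1.2).

Lemma F_le i j : i <= j -> j < n -> F i <= F j.
Proof.
elim: j => [|j IH]; first by rewrite leqn0 => /eqP->.
rewrite leq_eqVlt => /orP[/eqP-> //|]; rewrite ltnS => ij jn.
by apply: leq_trans (IH ij (ltnW jn)) _; apply: ltnW; apply: F_mono.
Qed.

Lemma F_gap i d : i + d < n -> F i + d <= F (i + d).
Proof.
elim: d => [|d IH]; first by rewrite !addn0.
rewrite addnS => H; have := F_mono H; have := IH (ltnW H); lia.
Qed.

Lemma lchunk_spec j a b (s := lchunk j a b) : a < b ->
  [/\ 0 < s, a + s <= b, s <= 2 ^ j, F (a + s).-1 <= F a + r &
      a + s < b -> s = 2 ^ j \/ F a + r < F (a + s)].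
Proof.
move=> ab; rewrite /s /lchunk.
have [||s_gt0 s_le /andP[s_j s_F] s_max] := bigmax_ord_spec
  (m := b - a) (P := fun s => (s <= 2 ^ j) && (F (a + s).-1 <= F a + r)).
- lia.
- by rewrite expn_gt0 /= addn1 leq_addr.
move: s_gt0 s_le s_j s_F s_max; set t := \max_(i < _ | _) _ => t_gt0 t_le t_j t_F t_max.
split=> //; first by lia.
move=> lt; have /nandP[H|] : ~~ ((t.+1 <= 2 ^ j) && (F (a + t.+1).-1 <= F a + r)).
- by apply: t_max; lia.
- by left; apply/eqP; rewrite eqn_leq t_j leqNgt.
by rewrite -ltnNge addnS /=; right.
Qed.

Lemma rchunk_spec j a b (s := rchunk j a b) : a < b ->
  [/\ 0 < s, a + s <= b, s <= 2 ^ j, F b.-1 <= F (b - s) + r &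
      a + s < b -> s = 2 ^ j \/ F (b - s).-1 + r < F b.-1].
Proof.
move=> ab; rewrite /s /rchunk.
have [||s_gt0 s_le /andP[s_j s_F] s_max] := bigmax_ord_spec
  (m := b - a) (P := fun s => (s <= 2 ^ j) && (F b.-1 <= F (b - s) + r)).
- lia.
- by rewrite expn_gt0 /= subn1 leq_addr.
move: s_gt0 s_le s_j s_F s_max; set t := \max_(i < _ | _) _ => t_gt0 t_le t_j t_F t_max.
split=> //; first by lia.
move=> lt; have /nandP[H|] : ~~ ((t.+1 <= 2 ^ j) && (F b.-1 <= F (b - t.+1) + r)).
- by apply: t_max; lia.
- by left; apply/eqP; rewrite eqn_leq t_j leqNgt.
by rewrite -ltnNge subnS; right.
Qed.

Lemma ok_init : 1 < n -> okb (Bd 1 1 n n J).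
Proof. by move=> n1; split; rewrite /lbusy /rbusy //= ?subnn ?ltnn // ltnW. Qed.

Lemma ok_finish m w : okb w -> okb (finish m w).
Proof.
move=> [l0 l1 l2 l3 l4 l5 sl sr wl wr ww]; rewrite /finish; case: ifP => _; last case: ifP => _ //;
  split; rewrite /lbusy /rbusy /= ?ltnn ?subnn //; try lia.
- by move=> jJ lh; apply: leq_trans (_ : F (lo w) + r <= _);
    rewrite ?leq_add2r; [apply: ww; lia | apply: F_le; lia].
- by move=> jJ lh; apply: leq_trans (_ : F (hi w).-1 <= _);
    [apply: F_le; lia | apply: ww; lia].
Qed.

Lemma potential_finish m w : potential (finish m w) = potential w.
Proof. by rewrite /finish; case: ifP => _ //; case: ifP. Qed.

Section Reclaim.
Variable w : bd.
Hypothesis okw : okb w.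
Hypothesis unfound : (lo w).+1 < hi w.
Hypothesis free : ~~ (lbusy w && rbusy w).

(** At level 0 an assigned interval is a single node; with an empty middle and one side idle, [lo,
    hi) would have at most one node, against [unfound]. *)
Lemma reclaim_lev_gt0 : la w = rb w -> 0 < lev w.
Proof.
move=> ab; case: (okw) => l0 l1 l2 l3 l4 l5 sl sr wl wr ww; move: free unfound sl sr.
rewrite lt0n; case: eqP => // ->; rewrite /lbusy /rbusy; lia.
Qed.

(** With an empty middle and one side idle, [lo, hi) is exactly the interval of the other side and
    inherits its weight bound. *)
Lemma ok_reclaim : okb (reclaim w).
Proof.
rewrite /reclaim; case: eqP => // ab; have j_gt0 := reclaim_lev_gt0 ab.
have nj := nxt_lt j_gt0; case: (okw) => l0 l1 l2 l3 l4 l5 sl sr wl wr ww.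
split; rewrite /lbusy /rbusy /= ?ltnn ?subnn //; try lia.
move=> _ _; move: free; rewrite negb_and /lbusy /rbusy -!leqNgt => /orP[H|H].
- have -> : lo w = rb w by lia.
  by apply: wr; rewrite /rbusy; lia.
have -> : hi w = la w by lia.
by apply: wl; rewrite /lbusy; lia.
Qed.

Lemma reclaim_size : la w = rb w -> hi w - lo w <= 2 ^ lev w.
Proof.
case: (okw) => l0 l1 l2 l3 l4 l5 sl sr wl wr ww.
by move: free; rewrite /lbusy /rbusy; lia.
Qed.

Lemma potential_reclaim : potential (reclaim w) <= potential w.
Proof.
rewrite /reclaim; case: eqP => // ab; have j_gt0 := reclaim_lev_gt0 ab.
have nj := nxt_lt j_gt0; have szw := reclaim_size ab.
case: (okw) => l0 l1 l2 l3 l4 l5 sl sr wl wr ww.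
rewrite /potential /middle /= ab ltnn add0n.
have -> : (lo w < hi w) = true by lia.
have -> : (nxt (lev w) == J) = false by lia.
apply: leq_trans (Fut_nxt j_gt0 l5); rewrite leq_add2r.
apply: leq_add; rewrite ?leq_mul2l ?szw ?orbT //; apply/orP; right.
rewrite -ltnS ltn_divLR ?expn_gt0 // mulSn -expnD subnK; last exact: ltnW.
have : 0 < 2 ^ nxt (lev w) by rewrite expn_gt0.
by lia.
Qed.

Lemma reclaim_middle : la (reclaim w) < rb (reclaim w).
Proof.
case: (okw) => l0 l1 l2 l3 l4 l5 sl sr wl wr ww.
by rewrite /reclaim; case: eqP => /=; lia.
Qed.

Lemma reclaim_free :
  la (reclaim w) = lo (reclaim w) \/ rb (reclaim w) = hi (reclaim w).
Proof.
rewrite /reclaim; case: eqP => /=; first by left.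
by case: (okw) => l0 l1 l2 l3 l4 l5 sl sr wl wr ww; move: free; rewrite /lbusy /rbusy; lia.
Qed.
End Reclaim.

Section Assign.
Variable w : bd.
Hypothesis okw : okb w.
Hypothesis ab : la w < rb w.
Hypothesis free : la w = lo w \/ rb w = hi w.

Lemma ok_assign : okb (assign w).1.
Proof.
rewrite /assign; case: (okw) => l0 l1 l2 l3 l4 l5 sl sr wl wr ww; case: eqP => al /=.
- have [s_gt0 s_b s_j s_F _] := lchunk_spec (lev w) ab.
  by rewrite -al in l1 sl wl ww *; split; rewrite /lbusy /rbusy /= //; lia.
have rh : rb w = hi w by case: free.
have [s_gt0 s_b s_j s_F _] := rchunk_spec (lev w) ab.
by rewrite -rh in l3 l4 sr wr ww *; split; rewrite /lbusy /rbusy /= //; lia.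
Qed.

Lemma assign_left : la w = lo w ->
  [/\ (assign w).2 = lmission (assign w).1, lbusy (assign w).1 &
      rmission (assign w).1 = rmission w].
Proof.
move=> al; rewrite /assign al eqxx; split=> //.
by rewrite /lbusy /=; have [] := lchunk_spec (lev w) ab; rewrite -al; lia.
Qed.

Lemma assign_right : la w <> lo w ->
  [/\ (assign w).2 = rmission (assign w).1, rbusy (assign w).1 &
      lmission (assign w).1 = lmission w].
Proof.
move=> al; rewrite /assign; case: eqP => // _; split=> //.
rewrite /rbusy /=; have [] := rchunk_spec (lev w) ab.
by case: free => // ->; lia.
Qed.

Lemma lev_assign : lev (assign w).1 = lev w.
Proof. by rewrite /assign; case: eqP. Qed.

Lemma ceil_sub j m : 2 ^ j < m ->
  ((m - 2 ^ j + (2 ^ j).-1) %/ 2 ^ j).+1 <= (m + (2 ^ j).-1) %/ 2 ^ j.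
Proof.
move=> jm; have j0 : 0 < 2 ^ j by rewrite expn_gt0.
have -> : m + (2 ^ j).-1 = 2 ^ j + (m - 2 ^ j + (2 ^ j).-1) by lia.
by rewrite (divnDl _ (dvdnn (2 ^ j))) divnn j0.
Qed.

(** Common to both sides: [s] nodes are taken off one end and [a', b') remains. Strictness comes
    from the charge [4 * r] against the [3 * r] of [cost]. *)
Lemma potential_step a' b' s :
  0 < s -> s = (a' - la w) + (rb w - b') -> la w <= a' -> a' <= b' -> b' <= rb w ->
  (a' < b' -> s = 2 ^ lev w \/ r + (F b'.-1 - F a') < F (rb w).-1 - F (la w)) ->
  (a' < b' -> s = 2 ^ J -> r + (F b'.-1 - F a') <= F (rb w).-1 - F (la w)) ->
  middle (lev w) a' b' + 3 * r + 2 * K * s < middle (lev w) (la w) (rb w).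
Proof.
move=> s0 sE aa ab' bb.
have dE : rb w - la w = b' - a' + s. by lia.
move=> H HJ; have [_ la_lo _ rb_hi hi_n lev_J _ _ _ _ w_le] := okw.
have pow_gt0 : 0 < 2 ^ lev w by rewrite expn_gt0.
rewrite /middle ab dE (mulnDr (2 * K)); have [a'b'|] := ltnP a' b'; last first.
  rewrite -subn_eq0 => /eqP ->; rewrite muln0 !add0n ltn_add2r.
  case: ifP => _; first by clear -r_gt0; lia.
  apply: (@leq_trans (4 * r * 1)); first by clear -r_gt0; lia.
  rewrite leq_mul2l; apply/orP; right; rewrite divn_gt0 // -[X in X <= _]prednK //.
  by rewrite -addn1 addnC leq_add2r.
rewrite addnA ltn_add2r [X in X < _]addnAC ltn_add2r.
rewrite -dE; have {}H := H a'b'; have {}HJ := HJ a'b'.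
case: eqP => [jJ|jJ].
  have {H HJ} : r + (F b'.-1 - F a') <= F (rb w).-1 - F (la w).
    by case: H => [|/ltnW //]; rewrite jJ.
  by clear -r_gt0; lia.
(* Below the top level the chunk must have been stopped by its size: being stopped by its weight
   would need more than [r] inside [lo, hi). *)
have sj : s = 2 ^ lev w.
  case: H => // gap; exfalso.
  have G1 : F (rb w).-1 <= F (hi w).-1 by apply: F_le; lia.
  have G2 : F (lo w) <= F (la w) by apply: F_le; lia.
  have G3 : F (la w) + (a' - la w) <= F a'.
    by have := @F_gap (la w) (a' - la w); rewrite subnKC //; apply; lia.
  have G4 : F b'.-1 + (rb w - b') <= F (rb w).-1.
    have := @F_gap b'.-1 (rb w - b').
    have -> : b'.-1 + (rb w - b') = (rb w).-1 by lia.
    by apply; lia.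
  have G5 : F (hi w).-1 <= F (lo w) + r by apply: w_le; lia.
  have G6 : F a' <= F b'.-1 by apply: F_le; lia.
  clear -gap G1 G2 G3 G4 G5 G6 sE s0 aa bb; lia.
have lt : 2 ^ lev w < rb w - la w by rewrite dE -sj -subn_gt0 addnK subn_gt0.
have := ceil_sub lt; rewrite -sj [X in X - s]dE addnK.
rewrite -(leq_pmul2l (m := 4 * r)) ?muln_gt0 //; clear -r_gt0.
by set q := _ %/ _; set q' := _ %/ _; lia.
Qed.

Lemma potential_assign :
  potential (assign w).1 + cost (assign w).2 < potential w.
Proof.
rewrite /potential lev_assign addnAC ltn_add2r /assign /cost.
case: (okw) => l0 l1 l2 l3 l4 l5 sl sr wl wr ww; case: eqP => al /=.
- have [s_gt0 s_b s_j s_F s_max] := lchunk_spec (lev w) ab.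
  set s := lchunk _ _ _ in s_gt0 s_b s_j s_F s_max *.
  have -> : la w + s - lo w = s by lia.
  rewrite addnA; apply: potential_step => //; try lia.
  + move=> lt; case: (s_max lt); [by left | move=> gap; right].
    have : F (la w + s) <= F (rb w).-1 by apply: F_le; lia.
    by lia.
  (* As [F] is strictly increasing, [2 ^ J >= r] nodes carry weight at least [r]. *)
  move=> lt sJ; have : F (la w + s) <= F (rb w).-1 by apply: F_le; lia.
  by have := @F_gap (la w) s; lia.
have rh : rb w = hi w by case: free.
have [s_gt0 s_b s_j s_F s_max] := rchunk_spec (lev w) ab.
set s := rchunk _ _ _ in s_gt0 s_b s_j s_F s_max *.
have -> : hi w - (rb w - s) = s by lia.
rewrite addnA; apply: potential_step => //; try lia.
- move=> lt; case: s_max; [by lia | by left | move=> gap; right].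
  have : F (la w) <= F (rb w - s).-1 by apply: F_le; lia.
  by lia.
move=> lt sJ; have := @F_gap (rb w - s).-1 s.
have -> : (rb w - s).-1 + s = (rb w).-1 by lia.
have : F (la w) <= F (rb w - s).-1 by apply: F_le; lia.
by lia.
Qed.
End Assign.

End Dispatch.

(* [Run m t true]: on the link between the t-th and the next node of the route
   of the mission m.  [Dead m] was killed during m. *)
Inductive activity := Idle | Run of mission & nat & bool | Dead of mission | Rep of nat.

Record state (k : nat) := State {
  wb : bd; ag : 'I_k -> activity; fl : 'I_k -> nat; mv : nat }.

Definition owned (a : activity) : option mission :=
  match a with Run m _ _ | Dead m => Some m | _ => None end.

Definition between (m : mission) (i : nat) := m.1.2 <= i < m.2.

(* The nodes that the route of m may visit, apart from the homebase. *)
Definition reach (m : mission) (i : nat) := if m.1.1 then i < m.2 else m.1.2 <= i.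

Lemma sum_upd (k : nat) (A : Type) (f : 'I_k -> A) i a (g : A -> nat) :
  \sum_j g (upd f i a j) + g (f i) = \sum_j g (f j) + g a.
Proof.
rewrite (bigD1 i) //= [in RHS](bigD1 i) //= /upd eqxx.
rewrite addnAC [RHS]addnAC [g a + _]addnC; congr (_ + _).
by apply: eq_bigr => j /negbTE ->.
Qed.

(** * Executions up to the first coin flip *)

Section FirstFlip.
Variables (T : finType) (e : rel T) (h b : T) (k : nat) (P : protocol T).
Implicit Types (c : coins k) (x : config k P).

Lemma flips_step c i x j : flips x j <= flips (step e h b c i x) j.
Proof.
rewrite /step; case: (agent x i) => [m y|m y z|z|] //.
  by case: (if y == h then _ else _) => w [m'|m' z|z] //; case: ifP.
by case: ifP => //= _; rewrite /upd; case: eqP => // ->.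
Qed.

Lemma step_flipless c c' i x : (forall j, flips (step e h b c i x) j = 0) ->
  step e h b c' i x = step e h b c i x.
Proof.
rewrite /step; case: (agent x i) => [m y|m y z|z|] //.
by case: ifP => //= _ /(_ i); rewrite /upd eqxx.
Qed.

Lemma flips_step_coins c c' i x j :
  flips (step e h b c i x) j = flips (step e h b c' i x) j.
Proof. by rewrite /step; case: (agent x i) => // m y z; case: ifP. Qed.

Lemma flips_step_other c i x j : j != i -> flips (step e h b c i x) j = flips x j.
Proof.
move=> /negbTE ji; rewrite /step; case: (agent x i) => [m y|m y z|z|] //.
  by case: (if y == h then _ else _) => w [m'|m' z|z] //; case: ifP.
by case: ifP => //= _; rewrite /upd ji.
Qed.

Variable sch : scheduler k P.

Lemma runS c t : run e h b sch c t.+1 =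
  step e h b c (scheduled e h b sch c t) (run e h b sch c t).
Proof. by rewrite /run /scheduled /=; case: (history e h b sch c t). Qed.

Lemma flips_run c t d i : flips (run e h b sch c t) i <= flips (run e h b sch c (t + d)) i.
Proof.
elim: d => [|d IH]; first by rewrite addn0.
by rewrite addnS runS; apply: leq_trans IH (flips_step _ _ _ _).
Qed.

Definition calm c t := forall i, flips (run e h b sch c t) i = 0.

Lemma calm_le c t d : calm c (t + d) -> calm c t.
Proof. by move=> cm i; apply/eqP; rewrite -leqn0 -(cm i) flips_run. Qed.

Lemma history_calm c c' t : calm c t ->
  history e h b sch c' t = history e h b sch c t.
Proof.
elim: t => [//|t IH] cm; have := cm; rewrite /calm runS /= IH; last first.
  by apply: (@calm_le c t 1); rewrite addn1.
rewrite /run /scheduled /=; case: (history e h b sch c t) => x past /= fl0.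
by rewrite (step_flipless _ fl0).
Qed.

(* Up to the first coin the execution does not depend on the coins. *)
Lemma first_flipper : exists i0, forall c t, calm c t ->
  forall i, 0 < flips (run e h b sch c t.+1) i -> i = i0.
Proof.
(* A reference sequence of coins, with which every other one is compared; which sequence is chosen
   does not matter before the first flip. *)
pose c0 : coins k := fun _ _ => true.
pose first t i := calm c0 t /\ 0 < flips (run e h b sch c0 t.+1) i.
have to_c0 c t i : calm c t -> 0 < flips (run e h b sch c t.+1) i -> first t i.
  move=> cm; have hE := history_calm c0 cm; rewrite /first /calm !runS.
  rewrite /run /scheduled hE -/(run e h b sch c t) (flips_step_coins _ c0).
  by split.
have first_sch t i : first t i -> i = scheduled e h b sch c0 t.
  move=> [cm]; rewrite runS; case: (eqVneq i (scheduled e h b sch c0 t)) => // ne.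
  by rewrite flips_step_other // cm.
have first_uniq t t' i i' : first t i -> first t' i' -> t <= t'.
  move=> [cm _] [_ f']; rewrite leqNgt; apply/negP => lt.
  move: cm f'; rewrite -(subnKC lt) => /calm_le /(_ i'); by move=> ->.
case: (pselect (exists t i, first t i)) => [[t [i f]]|nof]; last first.
  exists (scheduled e h b sch c0 0) => c t cm i fi; case: nof.
  by exists t, i; apply: to_c0 cm fi.
exists i => c t' cm i' /(to_c0 _ _ _ cm) f'.
have tt' : t = t' by apply/eqP; rewrite eqn_leq (first_uniq _ _ _ _ f f') (first_uniq _ _ _ _ f' f).
by rewrite (first_sch _ _ f) (first_sch _ _ f') tt'.
Qed.

End FirstFlip.

(** * Requirements on the routes, and the effect of one dispatch *)

Section Protocol.
Variables (T : finType) (e : rel T) (h : T) (vs : seq T).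
Variables (F nxt : nat -> nat) (r J K : nat) (Fut rho : nat -> nat).
Variable route : mission -> seq T.
Let n := size vs.
Hypothesis vs_uniq : uniq vs.
Hypothesis vs_all : forall x, x \in vs.
Hypothesis vs_h : index h vs = 0.
Hypothesis n_gt1 : 1 < n.
Hypothesis r_gt0 : 0 < r.
Hypothesis F_mono : forall i, i.+1 < n -> F i < F i.+1.
Hypothesis r_le_J : r <= 2 ^ J.
Hypothesis nxt_lt : forall j, 0 < j -> nxt j < j.
(** [rho j] bounds the number of reclaims still possible from level [j], hence the agents lost to
    them. *)
Hypothesis rho_nxt : forall j, 0 < j -> rho (nxt j) < rho j.
Hypothesis Fut_nxt : forall j, 0 < j -> j <= J ->
  4 * r * 2 ^ (j - nxt j) + 2 * K * 2 ^ j + Fut (nxt j) <= Fut j.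

Definition valid (m : mission) : bool :=
  [&& 0 < m.1.2, m.1.2 < m.2, m.2 <= n & F m.2.-1 <= F m.1.2 + r].

Definition node (m : mission) (t : nat) : T := nth h (h :: route m) t.

Definition crossing (b : T) (m : mission) (t : nat) : bool :=
  (node m t == b) || (node m t.+1 == b).

Hypothesis route_path : forall m, valid m -> path e h (route m).
Hypothesis route_last : forall m, valid m -> last h (route m) = h.
Hypothesis route_size : forall m, valid m -> size (route m) <= cost r K m.
Hypothesis route_cross : forall m i, valid m -> between m i ->
  (2 * K).+1 <= count (crossing (nth h vs i) m) (iota 0 (size (route m))).
Hypothesis route_reach : forall m t, valid m ->
  node m t = h \/ reach m (index (node m t) vs).

Let disp := dispatch F nxt r.
Let ok := okb F r n J.
Let pot := potential F r J K Fut.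

Lemma disp_wait w : disp w = Wait -> lbusy w && rbusy w.
Proof. by rewrite /disp /dispatch; do 2!case: ifP => // _; case: assign. Qed.

Lemma disp_located w : disp w = Located -> hi w <= (lo w).+1.
Proof. by rewrite /disp /dispatch; do 2!case: ifP => // _; case: assign. Qed.

(** [w1] is the whiteboard between a possible reclaim and the assignment; it is exposed because the
    invariants change in different ways in these two stages. *)
Lemma disp_send w w' m : ok w -> disp w = Send w' m ->
  [/\ ok w', valid m, pot w' + cost r K m < pot w &
      [/\ lo w' = lo w, hi w' = hi w &
      exists w1, [/\ w1 = w \/
        [/\ 0 < J, w1 = Bd (lo w) (lo w) (hi w) (hi w) (nxt (lev w)),
            rho (lev w1) < rho (lev w) & ~~ (lbusy w && rbusy w)],
        lev w' = lev w1 &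
        if m.1.1 then [/\ m = lmission w', lbusy w', ~~ lbusy w1 & rmission w' = rmission w1]
        else [/\ m = rmission w', rbusy w', ~~ rbusy w1 & lmission w' = lmission w1]]]].
Proof.
move=> okw; rewrite /disp /dispatch; case: (leqP (hi w)) => // unf; case: ifPn => // free.
have ok1 := ok_reclaim r_gt0 r_le_J nxt_lt okw unf free.
have mid1 := reclaim_middle nxt r_gt0 r_le_J okw unf free.
have free1 := reclaim_free nxt r_gt0 r_le_J okw unf free.
have pot1 := potential_reclaim r_gt0 r_le_J nxt_lt Fut_nxt okw unf free.
case E : (assign F r (reclaim nxt w)) => [w2 m2] [<- <-] {w' m}.
have ok2 := ok_assign r_gt0 r_le_J ok1 mid1 free1.
have pot2 := potential_assign K Fut r_gt0 F_mono r_le_J ok1 mid1 free1.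
rewrite E /= in ok2 pot2.
have pot3 := leq_trans pot2 pot1.
have lh : lo w2 = lo w /\ hi w2 = hi w.
  have [<- <-] : lo (reclaim nxt w) = lo w /\ hi (reclaim nxt w) = hi w.
    by rewrite /reclaim; case: ifP.
  by move: E; rewrite /assign; case: ifP => _ [<- _].
have levE : lev w2 = lev (reclaim nxt w) by have := lev_assign F r (reclaim nxt w); rewrite E.
have spec : if m2.1.1
    then [/\ m2 = lmission w2, lbusy w2, ~~ lbusy (reclaim nxt w) &
      rmission w2 = rmission (reclaim nxt w)]
    else [/\ m2 = rmission w2, rbusy w2, ~~ rbusy (reclaim nxt w) &
      lmission w2 = lmission (reclaim nxt w)].
  case: (eqVneq (la (reclaim nxt w)) (lo (reclaim nxt w))) => [al|/eqP al].
    have := assign_left F r_gt0 r_le_J mid1 free1 al; rewrite E /= => -[-> lb ->] /=; split=> //.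
    by rewrite /lbusy al ltnn.
  have := assign_right F r_gt0 r_le_J mid1 free1 al; rewrite E /= => -[-> lb ->] /=; split=> //.
  by case: free1 => // rh; rewrite /rbusy rh ltnn.
split=> //.
- case: (ok2) => l0 l1 l2 l3 l4 l5 sl sr wl wr ww; move: spec.
  case: ifP => _ [-> mb _ _]; rewrite /valid /=.
  + by rewrite (wl mb); move: mb; rewrite /lbusy; lia.
  + by rewrite (wr mb); move: mb; rewrite /rbusy; lia.
split; try by case: lh.
exists (reclaim nxt w); split=> //.
have lev0 := reclaim_lev_gt0 r_gt0 r_le_J okw unf free; have levJ := ok_lev okw.
rewrite /reclaim; case: eqP => [ab|]; [right | by left].
have {}lev0 := lev0 ab.
by split=> //=; [apply: leq_trans levJ | apply: rho_nxt].
Qed.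

(** * Abstract executions and their invariants *)

Section Run.
Variables (k : nat) (b : T).
Hypothesis b_h : b != h.
Let beta := index b vs.

(** A killed agent keeps its mission in [Dead]: this ghost information, invisible to the protocol,
    lets the invariants speak about owners of intervals. *)
Definition astep (c : coins k) (i : 'I_k) (x : state k) : state k :=
  let w := wb x in
  match ag x i with
  | Idle =>
      match disp w with
      | Wait => x
      | Located => State w (upd (ag x) i (Rep (lo w))) (fl x) (mv x)
      | Send w' m => State w' (upd (ag x) i (Run m 0 false)) (fl x) (mv x)
      end
  | Run m t false =>
      if t < size (route m) then
        State w (upd (ag x) i (Run m t true)) (fl x) (mv x).+1
      else State (finish m w) (upd (ag x) i Idle) (fl x) (mv x)
  | Run m t true =>
      if crossing b m t then
        State w (upd (ag x) i (if c i (fl x i) then Dead m else Run m t.+1 false))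
          (upd (fl x) i (fl x i).+1) (mv x)
      else State w (upd (ag x) i (Run m t.+1 false)) (fl x) (mv x)
  | Dead _ | Rep _ => x
  end.

Definition astate0 : state k :=
  State (Bd 1 1 n n J) (fun _ => Idle) (fun _ => 0) 0.

Fixpoint arun (c : coins k) (sigma : nat -> 'I_k) (t : nat) : state k :=
  if t is t'.+1 then astep c (sigma t') (arun c sigma t') else astate0.

Definition wf_activity (a : activity) : Prop :=
  match a with
  | Run m t tr => [/\ valid m, t <= size (route m) & tr -> t < size (route m)]
  | Dead m => valid m /\ reach m beta
  | _ => True
  end.

Definition wf (x : state k) : Prop := ok (wb x) /\ forall i, wf_activity (ag x i).

Lemma crossing_reach m t : valid m -> crossing b m t -> reach m beta.
Proof.
have b_reach u : valid m -> node m u = b -> reach m beta.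
  by move=> vm E; have := @route_reach m u vm; rewrite E => -[bh|//]; move: b_h; rewrite bh eqxx.
by move=> vm /orP[] /eqP; apply: b_reach.
Qed.

Lemma wf_run0 : wf astate0.
Proof. by split=> //; apply: ok_init. Qed.

Lemma wf_step c i x : wf x -> wf (astep c i x).
Proof.
move=> [okx wfx]; have := wfx i; rewrite /astep; case E: (ag x i) => [|m t []|m|z] //=.
- case D: (disp (wb x)) => [||w' m] //= _.
    by split=> //= j; rewrite /upd; case: eqP.
  have [ok' vm _ _] := disp_send okx D.
  by split=> //= j; rewrite /upd; case: eqP.
- move=> [vm tle /(_ isT) tlt]; case: ifP => cr; split=> //= j; rewrite /upd; case: eqP => // _.
    by case: ifP => _ //=; split=> //; apply: crossing_reach vm cr.
- move=> [vm tle _]; case: ifP => tlt; split=> //=; try by move=> j; rewrite /upd; case: eqP.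
  exact: (ok_finish r_gt0 F_mono r_le_J).
Qed.

Lemma wf_run c sigma t : wf (arun c sigma t).
Proof. by elim: t => [|t IH]; [apply: wf_run0 | apply: wf_step]. Qed.

(** Two units per link, since entering a link and reaching its end are separate actions; only the
    first counts as a move. *)
Definition work (a : activity) : nat :=
  match a with
  | Idle => 1
  | Run m t tr => 2 * (size (route m) - t) + 2 - tr
  | _ => 0
  end.

Definition fuel (x : state k) : nat := 3 * pot (wb x) + \sum_i work (ag x i).

(** A dispatch lowers [pot] by more than the length of the new route, and three times this drop
    exceeds the [work] that the route adds. Any other action that changes the state lowers [work] by
    at least one, which pays for the move if it starts one. *)
Lemma fuel_step c i x (y := astep c i x) : wf x ->
  mv y + fuel y <= mv x + fuel x /\ (y = x \/ fuel y < fuel x).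
Proof.
move=> [okx wfx]; have := wfx i; rewrite /y /astep /fuel; case E: (ag x i) => [|m t []|m|z] //=.
- case D: (disp (wb x)) => [||w' m] //= _; try by [split; [|left]];
  have := sum_upd (ag x) i _ work; rewrite E.
    by move=> /(_ (Rep (lo (wb x)))) /=; lia.
  move=> /(_ (Run m 0 false)) /=.
  have [ok' vm potlt _] := disp_send okx D; have := route_size vm; lia.
- move=> [vm tle /(_ isT) tlt]; have S := sum_upd (ag x) i _ work.
  rewrite E /= in S; case: ifP => cr /=; last by have := S (Run m t.+1 false); rewrite /=; lia.
  case: ifP => _; first by have := S (Dead m); rewrite /=; lia.
  by have := S (Run m t.+1 false); rewrite /=; lia.
- move=> [vm tle _]; have S := sum_upd (ag x) i _ work; rewrite E /= in S.
  case: ifP => tlt /=; first by have := S (Run m t true); rewrite /=; lia.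
  have := S Idle; have := potential_finish F r J K Fut m (wb x); rewrite -/pot => -> /=.
  by lia.
- by split=> //; left.
- by split=> //; left.
Qed.

Lemma mv_run c sigma t : mv (arun c sigma t) <= 3 * pot (Bd 1 1 n n J) + k.
Proof.
have -> : 3 * pot (Bd 1 1 n n J) + k = mv astate0 + fuel astate0.
  by rewrite /fuel /= sum1_card card_ord.
apply: (@leq_trans (mv (arun c sigma t) + fuel (arun c sigma t))); first exact: leq_addr.
elim: t => [//|t IH]; apply: leq_trans IH.
by have [] := fuel_step c (sigma t) (wf_run c sigma t).
Qed.

Definition busy (a : activity) : nat := owned a != None.

(* Each reclaimed interval costs at most one agent besides those in charge of
   the current intervals. *)
Definition staffed (x : state k) : Prop :=
  [/\ \sum_i busy (ag x i) + rho (lev (wb x)) <= lbusy (wb x) + rbusy (wb x) + rho J,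
      lbusy (wb x) -> exists i, owned (ag x i) = Some (lmission (wb x)) &
      rbusy (wb x) -> exists i, owned (ag x i) = Some (rmission (wb x))].

(** A reclaim occurs with at most one busy side and leaves none, so the right-hand side loses at
    most one while [rho] of the level drops by at least one. An agent that finishes an interval no
    longer current only lowers the left-hand side. *)
Lemma staffed_step c i x : wf x -> staffed x -> staffed (astep c i x).
Proof.
move=> [okx wfx] [cnt own_l own_r].
have keep a : owned a = owned (ag x i) ->
    [/\ \sum_j busy (upd (ag x) i a j) = \sum_j busy (ag x j) &
    forall m, (exists j, owned (ag x j) = Some m) -> exists j, owned (upd (ag x) i a j) = Some m].
  move=> aE; split; last first.
    by move=> m [j Ej]; exists j; rewrite /upd; case: eqP => // ji; rewrite aE -ji.
  by apply: eq_bigr => j _; rewrite /upd; case: eqP => // ->; rewrite /busy aE.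
have S a := sum_upd (ag x) i a busy.
have := wfx i; rewrite /astep; case E: (ag x i) keep S => [|m t []|m|z] keep S //=.
- case D: (disp (wb x)) => [||w' m] //= _.
    have [cE ow] := keep (Rep (lo (wb x))) erefl.
    by split; rewrite /= ?cE // => H; apply: ow; auto.
  have {S}S : \sum_j busy (upd (ag x) i (Run m 0 false) j) = \sum_j busy (ag x j) + 1.
    by have := S (Run m 0 false); rewrite /busy /= addn0.
  have ow m' : (exists j, owned (ag x j) = Some m') ->
    exists j, owned (upd (ag x) i (Run m 0 false) j) = Some m'.
    by move=> [j Ej]; exists j; rewrite /upd; case: eqP Ej => // ->; rewrite E.
  have new : exists j, owned (upd (ag x) i (Run m 0 false) j) = Some m.
    by exists i; rewrite /upd eqxx.
  have [_ _ _ [_ _ [w1 [w1E levE spec]]]] := disp_send okx D.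
  have cnt1 : \sum_j busy (ag x j) + rho (lev w1) <= lbusy w1 + rbusy w1 + rho J.
    case: w1E => [-> //|[_ w1E rlt nb]].
    have one : lbusy (wb x) + rbusy (wb x) <= 1 by case: (lbusy _) nb; case: (rbusy _).
    have -> : lbusy w1 = false by rewrite w1E /lbusy ltnn.
    have -> : rbusy w1 = false by rewrite w1E /rbusy ltnn.
    by move: cnt; rewrite -ltnS in rlt; lia.
  have own1l : lbusy w1 -> exists j, owned (ag x j) = Some (lmission w1).
    by case: w1E => [-> //|[_ -> _ _]]; rewrite /lbusy /= ltnn.
  have own1r : rbusy w1 -> exists j, owned (ag x j) = Some (rmission w1).
    by case: w1E => [-> //|[_ -> _ _]]; rewrite /rbusy /= ltnn.
  rewrite /staffed /= levE S; case: ifP spec => _ [mE mb free oE].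
  + have lb : rbusy w' = rbusy w1 by case: oE => bE hE; rewrite /rbusy bE hE.
    split; first by rewrite mb lb; move: cnt1; rewrite (negbTE free); lia.
    * by move=> _; rewrite -mE.
    * by rewrite lb oE => H; apply: ow; apply: own1r.
  + have lb : lbusy w' = lbusy w1 by case: oE => bE hE; rewrite /lbusy bE hE.
    split; first by rewrite mb lb; move: cnt1; rewrite (negbTE free); lia.
    * by rewrite lb oE => H; apply: ow; apply: own1l.
    * by move=> _; rewrite -mE.
- move=> [vm tle _].
  case: ifP => _; last first.
    have [cE ow] := keep (Run m t.+1 false) erefl.
    by split; rewrite /= ?cE // => H; apply: ow; auto.
  have [cE ow] := keep (if c i (fl x i) then Dead m else Run m t.+1 false)
    ltac:(by case: ifP).
  by split; rewrite /= ?cE // => H; apply: ow; auto.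
- move=> [vm tle _].
  case: ifP => _.
    have [cE ow] := keep (Run m t true) erefl.
    by split; rewrite /= ?cE // => H; apply: ow; auto.
  have {S}S : \sum_j busy (upd (ag x) i Idle j) + 1 = \sum_j busy (ag x j).
    by have := S Idle; rewrite /busy /= addn0.
  have ow m' : m' <> m -> (exists j, owned (ag x j) = Some m') ->
    exists j, owned (upd (ag x) i Idle j) = Some m'.
    move=> mm' [j Ej]; exists j; rewrite /upd; case: eqP Ej => // ->; rewrite E.
    by move=> [mE]; case: mm'.
  move: vm => /and4P[_ xy _ _].
  rewrite /staffed /finish; case: eqP => [mE|ml] /=; last case: eqP => [mE|mr] /=.
  + rewrite [lbusy (Bd _ _ _ _ _)]ltnn; split=> //.
    * have lb : lbusy (wb x) by move: xy; rewrite mE.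
      rewrite -[rbusy (Bd _ _ _ _ _)]/(rbusy (wb x)).
      by move: cnt; rewrite -S lb addn1 add0n add1n !addSn ltnS.
    * by move=> rb; apply: ow; [rewrite mE | apply: own_r].
  + rewrite [rbusy (Bd _ _ _ _ _)]ltnn; split=> //.
    * have lb : rbusy (wb x) by move: xy; rewrite mE.
      rewrite -[lbusy (Bd _ _ _ _ _)]/(lbusy (wb x)).
      by move: cnt; rewrite -S lb !addn1 addn0 !addSn ltnS.
    * by move=> lb; apply: ow; [rewrite mE | apply: own_l].
  + split; first by apply: leq_trans cnt; rewrite -S leq_add2r leq_addr.
    * by move=> lb; apply: ow; [move=> mE; apply: ml | apply: own_l].
    * by move=> lb; apply: ow; [move=> mE; apply: mr | apply: own_r].
Qed.

Lemma staffed_run c sigma t : staffed (arun c sigma t).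
Proof.
elim: t => [|t IH]; last exact: staffed_step (wf_run _ _ _) IH.
by rewrite /staffed /lbusy /rbusy /= !ltnn; split=> //; rewrite big1 // => i _.
Qed.

(** Without a report, every owner that cannot act is dead, so its mission reaches the hole. The two
    current intervals have disjoint reaches, so they are not both busy; then at most [rho J + 1]
    agents are owners, some agent is idle, and [dispatch] does not make it wait. *)
Lemma quiet_reported c x : rho J + 2 <= k -> wf x -> staffed x ->
  (forall i, astep c i x = x) -> exists i z, ag x i = Rep z.
Proof.
move=> k_big [okx wfx] [cnt own_l own_r] quiet; apply: contrapT => norep.
have dead i m : owned (ag x i) = Some m -> reach m beta.
  have := wfx i; have := congr1 (fun y => ag y i) (quiet i); rewrite /astep.
  case E: (ag x i) => [|m' t tr|m'|z] //=; last by move=> _ [_ rb] [<-].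
  case: tr E => E.
    by case: ifP => _; rewrite /= /upd eqxx //; case: ifP.
  by case: ifP => _; rewrite /= /upd eqxx.
have free : ~~ (lbusy (wb x) && rbusy (wb x)).
  apply/negP => /andP[lb rb]; have [i /dead] := own_l lb; have [j /dead] := own_r rb.
  by rewrite /reach /=; have := ok_rb okx; lia.
have [i idle] : exists i, ag x i = Idle.
  apply: contrapT => noidle.
  have : \sum_i busy (ag x i) = k.
    rewrite -[RHS]card_ord -sum1_card; apply: eq_bigr => i _.
    case E: (ag x i) => //; exfalso; first by apply: noidle; exists i.
    by apply: norep; exists i; eexists; apply: E.
  have : lbusy (wb x) + rbusy (wb x) <= 1 by case: (lbusy _) free; case: (rbusy _).
  lia.
have := congr1 (fun y => ag y i) (quiet i); rewrite /astep idle.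
case D: (disp (wb x)) => [||w m]; rewrite /= ?/upd ?eqxx ?idle //.
by move=> _; move: free; rewrite (disp_wait D).
Qed.

Definition stopped (a : activity) : Prop :=
  match a with Rep _ | Dead _ => True | _ => False end.

(** [fuel] attains its minimum, after which no action changes the state; by fairness every agent is
    then at rest. The coins are arbitrary, so survival is certain and not merely likely. *)
Lemma some_report c sigma : rho J + 2 <= k ->
  (forall i t, exists2 t', t <= t' &
    sigma t' = i \/ stopped (ag (arun c sigma t') i)) ->
  exists t i z, ag (arun c sigma t) i = Rep z.
Proof.
move=> k_big fair.
have fuel_le t d : fuel (arun c sigma (t + d)) <= fuel (arun c sigma t).
  elim: d => [|d IH]; first by rewrite addn0.
  rewrite addnS; apply: leq_trans IH => /=.
  by have [_ [->|/ltnW]] := fuel_step c (sigma (t + d)) (wf_run c sigma (t + d)).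
have [t0 t0_min] : exists t0, forall t, fuel (arun c sigma t0) <= fuel (arun c sigma t).
  pose P f := `[< exists t, fuel (arun c sigma t) = f >].
  have exP : exists f, P f by exists (fuel astate0); apply/asboolP; exists 0.
  have [f /asboolP[t0 <-] fmin] := ex_minnP exP.
  by exists t0 => t; apply: fmin; apply/asboolP; exists t.
have stable d : arun c sigma (t0 + d) = arun c sigma t0.
  elim: d => [|d IH]; first by rewrite addn0.
  rewrite addnS /=.
  have [_ [->//|]] := fuel_step c (sigma (t0 + d)) (wf_run c sigma (t0 + d)).
  by rewrite ltnNge IH -IH; have := t0_min (t0 + d).+1; rewrite /= -IH => ->.
have [|i [z iz]] := quiet_reported k_big (wf_run c sigma t0) (staffed_run c sigma t0)
    (c := c); last by exists t0, i, z.
move=> i; have [t' le] := fair i t0; have := stable (t' - t0); rewrite subnKC // => E.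
case=> [si|]; last by rewrite E /astep; case: (ag _ i).
have := stable (t' - t0).+1; rewrite addnS subnKC //= E si.
by [].
Qed.

(* The number of coins that the explorer of the hole is to flip is 2 K + 1. *)
Definition mortal (c : coins k) (i : 'I_k) : Prop := exists2 j, j <= 2 * K & c i j.

(** An agent that is not dead has survived all [f] coins of its past missions and the current one,
    so [f] is an upper bound for the crossings of the hole in the current one. *)
Definition honest_activity (c : coins k) (i : 'I_k) (f : nat) (a : activity) : Prop :=
  match a with
  | Idle => forall j, j < f -> c i j = false
  | Run m t _ => (forall j, j < f -> c i j = false) /\
      (between m beta -> count (crossing b m) (iota 0 t) <= f)
  | Dead _ => True
  | Rep z => z = beta
  end.

Definition honest (c : coins k) (x : state k) : Prop :=
  lo (wb x) <= beta < hi (wb x) /\ forall i, honest_activity c i (fl x i) (ag x i).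

Lemma honest_run0 c : honest c astate0.
Proof.
split=> //=; rewrite /n /beta index_mem vs_all andbT lt0n; apply/eqP => b0.
have hb : nth h vs 0 = b by rewrite -b0 nth_index.
by move: b_h; rewrite -hb -{2}[h](nth_index h (vs_all h)) vs_h eqxx.
Qed.

(** Completing a mission over the hole would require more than [2 * K] harmless coins from the first
    on. Mortality is asked only of agents that have flipped a coin, so that one mortal agent can
    suffice when [J = 0]. *)
Lemma finish_elsewhere c i x m : wf x -> honest c x ->
  (forall j, 0 < fl x j -> mortal c j) ->
  ag x i = Run m (size (route m)) false -> ~~ between m beta.
Proof.
move=> [okx wfx] [_ hon] mort E; apply/negP => bm.
have := wfx i; have := hon i; rewrite E /= => -[alive /(_ bm) cnt] [vm _ _].
have := route_cross vm bm; rewrite nth_index // => /leq_trans/(_ cnt) flips.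
have [j jK cj] := mort i (leq_ltn_trans (leq0n _) flips).
by have := alive j (leq_ltn_trans jK flips); rewrite cj.
Qed.

Lemma honest_step c i x : wf x -> honest c x ->
  (forall j, 0 < fl x j -> mortal c j) -> honest c (astep c i x).
Proof.
move=> wfx hx mort; have [okx wfa] := wfx; have [bx hon] := hx.
have others a : honest_activity c i (fl x i) a ->
    forall j, honest_activity c j (fl x j) (upd (ag x) i a j).
  by move=> ha j; rewrite /upd; case: eqP => // ->.
have := hon i; have := wfa i; rewrite /astep; case E: (ag x i) => [|m t []|m|z] //=.
- case D: (disp (wb x)) => [||w' m] //= _ alive.
    split=> //=; apply: others => /=; have := disp_located D; lia.
  have [_ _ _ [lE hE _]] := disp_send okx D.
  by split; rewrite /= ?lE ?hE //; apply: others.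
- move=> [vm tle _] [alive cnt].
  have cntS : count (crossing b m) (iota 0 t.+1) = count (crossing b m) (iota 0 t) + crossing b m t.
    by rewrite -addn1 iotaD count_cat /= addn0.
  case: ifP => cr; last first.
    by split=> //=; apply: others; split=> //; rewrite cntS cr addn0.
  split=> //= j; rewrite /upd; case: eqP => // ->.
  case: ifP => // ci; split; last by rewrite cntS cr addn1 ltnS.
  by move=> j'; rewrite ltnS leq_eqVlt => /orP[/eqP-> //|/alive].
- move=> [vm tle _] [alive cnt].
  case: ltnP => tlt /=; first by split=> //=; apply: others.
  have tE : t = size (route m) by apply/eqP; rewrite eqn_leq tle.
  have nb : ~~ between m beta by apply: (@finish_elsewhere c i x m wfx hx mort); rewrite E tE.
  split; last exact: others.
  have ab := ok_rb okx; have bh := ok_hi okx; move: bx nb; rewrite /finish /between.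
  case: eqP => [->|_] /=; last case: eqP => [->|_] //=.
    by clear; lia.
  by clear; lia.
Qed.

(** For [J = 0] nothing is ever taken back, so each current interval has one owner until it is
    completed. An agent that meets the hole owns the interval containing it and, being mortal, never
    completes it. *)
Definition exclusive (x : state k) : Prop :=
  [/\ forall i m, owned (ag x i) = Some m ->
        (m = lmission (wb x) /\ lbusy (wb x)) \/ (m = rmission (wb x) /\ rbusy (wb x)),
      forall i j m, owned (ag x i) = Some m -> owned (ag x j) = Some m -> i = j &
      forall i, 0 < fl x i -> exists2 m, owned (ag x i) = Some m & between m beta].

Lemma exclusive_step c i x : J = 0 -> wf x -> honest c x ->
  (forall j, 0 < fl x j -> mortal c j) -> exclusive x -> exclusive (astep c i x).
Proof.
move=> J0 wfx hx mort [cur uniq_own flip]; have [okx wfa] := wfx; have [bx hon] := hx.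
have keep a : owned a = owned (ag x i) -> forall j, owned (upd (ag x) i a j) = owned (ag x j).
  by move=> aE j; rewrite /upd; case: eqP => // ->.
have := wfa i; rewrite /astep; case E: (ag x i) keep => [|m t []|m|z] keep //=.
- case D: (disp (wb x)) => [||w' m] //= _.
    have {}keep := keep (Rep (lo (wb x))) erefl.
    split=> /=.
    + by move=> j m; rewrite keep; apply: cur.
    + by move=> j j' m; rewrite !keep; apply: uniq_own.
    + by move=> j; rewrite keep; apply: flip.
  have [_ vm _ [lE hE [w1 [w1E levE spec]]]] := disp_send okx D.
  case: w1E => [w1E|[]]; last by rewrite J0.
  rewrite {}w1E in spec.
  have new j m' : owned (ag x j) = Some m' -> m' <> m /\
    ((m' = lmission w' /\ lbusy w') \/ (m' = rmission w' /\ rbusy w')).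
    move/cur; case: ifP spec => side [mE mb free oE] [[-> jb]|[-> jb]].
    + by rewrite jb in free.
    + split; first by rewrite mE.
      by right; rewrite oE; split=> //; case: oE => bE h'E; rewrite /rbusy bE h'E.
    + split; first by rewrite mE.
      by left; rewrite oE; split=> //; case: oE => l'E aE; rewrite /lbusy l'E aE.
    + by rewrite jb in free.
  have cur' : (m = lmission w' /\ lbusy w') \/ (m = rmission w' /\ rbusy w').
    by case: ifP spec => _ [? ? _ _]; [left | right].
  split=> /=.
  + by move=> j m'; rewrite /upd; case: eqP => [_ [<-] //|_ /new[]].
  + move=> j j' m'; rewrite /upd; case: eqP => [->|_]; case: eqP => [->|_] //.
    * by move=> [<-] /new[].
    * by move=> /new[nm _] [mE]; case: nm.
    * exact: uniq_own.
  + move=> j /flip[m' j'm bm]; exists m' => //; rewrite /upd; case: eqP => // ji.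
    by move: j'm; rewrite ji E.
- move=> [vm tle _]; case: ifP => cr; last first.
    have {}keep := keep (Run m t.+1 false) erefl.
    split=> /=.
    + by move=> j m'; rewrite keep; apply: cur.
    + by move=> j j' m'; rewrite !keep; apply: uniq_own.
    + by move=> j; rewrite keep; apply: flip.
  have {}keep := keep (if c i (fl x i) then Dead m else Run m t.+1 false) ltac:(by case: ifP).
  split=> /=.
  + by move=> j m'; rewrite keep; apply: cur.
  + by move=> j j' m'; rewrite !keep; apply: uniq_own.
  + move=> j; rewrite keep {1}/upd; case: eqP => [-> _|_ /flip //].
    exists m; first by rewrite E.
    (* [reach] bounds the hole on one side only; the other bound is that the hole lies in [lo,
       hi). *)
    have := crossing_reach vm cr; have := cur i m; rewrite E /= => /(_ erefl).
    rewrite /reach /between => -[] [-> _] /=; [move=> lt | move=> ge].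
      by rewrite lt andbT; case/andP: bx.
    by rewrite ge /=; case/andP: bx.
- move=> [vm tle _]; case: ltnP => tlt /=.
    have {}keep := keep (Run m t true) erefl.
    split=> /=.
    + by move=> j m'; rewrite keep; apply: cur.
    + by move=> j j' m'; rewrite !keep; apply: uniq_own.
    + by move=> j; rewrite keep; apply: flip.
  have tE : t = size (route m) by apply/eqP; rewrite eqn_leq tle.
  have nb : ~~ between m beta by apply: (@finish_elsewhere c i x m wfx hx mort); rewrite E tE.
  have rest j m' : owned (upd (ag x) i Idle j) = Some m' ->
      owned (ag x j) = Some m' /\ m' <> m.
    rewrite /upd; case: eqP => // ji jm; split=> // mE; apply: ji.
    by apply: (uniq_own j i m); rewrite -?mE ?E // -mE.
  have curm : (m = lmission (wb x) /\ lbusy (wb x)) \/ (m = rmission (wb x) /\ rbusy (wb x)).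
    by apply: (cur i); rewrite E.
  split=> /=.
  + move=> j m' /rest[/cur cm' mm']; rewrite /finish.
    case: eqP => [mE|ml] /=; last case: eqP => [mE|mr] /=.
    * by case: cm' => -[m'E ?]; [case: mm'; rewrite mE | right].
    * by case: cm' => -[m'E ?]; [left | case: mm'; rewrite mE].
    * by case: curm => -[].
  + by move=> j j' m' /rest[jm _] /rest[j'm _]; apply: uniq_own jm j'm.
  + move=> j /flip[m' jm bm]; exists m' => //; rewrite /upd; case: eqP => // ji.
    by move: nb jm; rewrite ji E => /negP nb [mE]; case: nb; rewrite mE.
Qed.

Lemma exclusive_flipper x i j : wf x -> exclusive x ->
  0 < fl x i -> 0 < fl x j -> i = j.
Proof.
move=> [okx _] [cur uniq_own flip] /flip[m im bm] /flip[m' jm' bm'].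
suff mm' : m = m' by apply: uniq_own im _; rewrite mm'.
have := ok_rb okx; move: bm bm'; rewrite /between.
by case: (cur _ _ im) => -[-> _]; case: (cur _ _ jm') => -[-> _] //=; lia.
Qed.

End Run.

(** * The concrete protocol, with finite memory and whiteboard *)

Definition max_route : nat := 3 * r + 2 * K * n.

Definition mem := option (bool * 'I_n.+1 * 'I_n.+1 * 'I_max_route.+1).
Definition shared := ('I_n.+1 * 'I_n.+1 * 'I_n.+1 * 'I_n.+1 * 'I_J.+1)%type.

Definition encode_mem (m : mission) (t : nat) : mem :=
  Some (m.1.1, inord m.1.2, inord m.2, inord t).

Definition encode_bd (w : bd) : shared :=
  (inord (lo w), inord (la w), inord (rb w), inord (hi w), inord (lev w)).

Definition decode_bd (w : shared) : bd :=
  let: (l, a, b, h, j) := w in Bd l a b h j.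
Arguments decode_bd : simpl never.

Definition search_home (m : mem) (w : shared) : shared * decision T mem :=
  match m with
  | None =>
      match disp (decode_bd w) with
      | Wait => (w, Stay _ None)
      | Located => (w, Report _ (nth h vs (lo (decode_bd w))))
      | Send w' m' => (encode_bd w', Stay _ (encode_mem m' 0))
      end
  | Some (sd, x, y, t) =>
      let m := (sd, x : nat, y : nat) in
      if t < size (route m) then (w, Move (encode_mem m t.+1) (node m t.+1))
      else (encode_bd (finish m (decode_bd w)), Stay _ None)
  end.

(** There is no test for the end of the route: routes end at the homebase, so elsewhere a next node
    exists. *)
Definition search_away (m : mem) (u : T) : decision T mem :=
  match m with
  | None => Stay _ None
  | Some (sd, x, y, t) =>
      let m := (sd, x : nat, y : nat) in
      Move (encode_mem m t.+1) (node m t.+1)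
  end.

Definition search : protocol T :=
  @Protocol T mem shared None (encode_bd (Bd 1 1 n n J)) search_home search_away.

Lemma encode_bdK w : ok w -> decode_bd (encode_bd w) = w.
Proof.
move=> [l0 l1 l2 l3 l4 l5 _ _ _ _ _]; rewrite /encode_bd /decode_bd /=.
by case: w l0 l1 l2 l3 l4 l5 => l a b' h' j /= *; rewrite !inordK // ltnS; lia.
Qed.

(** The four positions take [n.+1 ^ 4 <= n ^ 8] values, as [n.+1 <= n ^ 2]; the remaining exponent
    is for the level. *)
Lemma search_board_size (cw : nat) : J.+1 <= n ^ cw -> small_board search (8 + cw).
Proof.
move=> Jn; have nT : n = #|T|.
  by rewrite /n cardE; apply/perm_size/uniq_perm; rewrite ?enum_uniq // => x;
    rewrite mem_enum vs_all.
rewrite /small_board -nT /= !card_prod !card_ord expnD leq_mul // (expnM n 2 4).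
have : n.+1 <= n ^ 2.
  rewrite -mulnn; apply: leq_trans (leq_mul n_gt1 (leqnn n)).
  by rewrite mul2n -addnn -addn1 leq_add2l ltnW.
have -> : n.+1 * n.+1 * n.+1 * n.+1 = n.+1 ^ 4 by rewrite !expnS expn0 muln1 !mulnA.
by rewrite leq_exp2r.
Qed.

(** * The protocol realises the abstract execution *)

Section Simulation.
Variables (k : nat) (b : T).
Hypothesis b_h : b != h.
Let beta := index b vs.

(** The memory is updated on entering a link, hence [t.+1] in transit. *)
Definition conc_activity (a : activity) : status T mem :=
  match a with
  | Idle => At None h
  | Run m t false => At (encode_mem m t) (node m t)
  | Run m t true => Transit (encode_mem m t.+1) (node m t) (node m t.+1)
  | Dead _ => Killed _ _
  | Rep z => Reported _ (nth h vs z)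
  end.

Definition conc (x : state k) : config k search :=
  Config (P := search) (encode_bd (wb x)) (fun i => conc_activity (ag x i)) (fl x) (mv x).

Lemma conc_upd (f : 'I_k -> activity) i a s : conc_activity a = s ->
  upd (fun j => conc_activity (f j)) i s = (fun j => conc_activity (upd f i a j)).
Proof. by move=> <-; apply/funext => j; rewrite /upd; case: eqP. Qed.

(** Well-formedness keeps every stored number in range, so [inord] loses nothing. *)
Lemma step_conc c i x : wf b x -> step e h b c i (conc x) = conc (astep b c i x).
Proof.
move=> [okx wfx]; have := wfx i; rewrite /step /astep /=.
case E: (ag x i) => [|m t tr|m|z] //= wfi.
- rewrite eqxx /search_home (encode_bdK okx); case D: (disp (wb x)) => [||w' m] /=.
  + rewrite (conc_upd _ _ (a := Idle)) //; congr Config; apply/funext => j.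
    by rewrite /upd; case: eqP => // ->; rewrite E.
  + have ln : lo (wb x) < n.+1 by case: okx => *; lia.
    by rewrite (inordK ln) (conc_upd _ _ (a := Rep (lo (wb x)))).
  + have [_ vm _ _] := disp_send okx D.
    rewrite (conc_upd _ _ (a := Run m 0 false)) //.
case: wfi => vm tle ttr; have := route_size vm.
have [m0 m12 mn _] := and4P vm => szle.
have tmax : t <= max_route.
  apply: leq_trans tle (leq_trans szle _); rewrite /cost /max_route.
  by rewrite leq_add2l leq_mul2l (leq_trans (leq_subr _ _) mn) orbT.
case: tr ttr E => [/(_ isT) tlt|_] E /=.
  rewrite -/(crossing b m t); case: ifP => cr; last first.
    by rewrite (conc_upd _ _ (a := Run m t.+1 false)).
  rewrite (conc_upd _ _ (a := if c i (fl x i) then Dead m else Run m t.+1 false)) //.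
  by case: ifP.
have mE : (m.1.1, (inord m.1.2 : 'I_n.+1) : nat, (inord m.2 : 'I_n.+1) : nat) = m.
  by rewrite !inordK ?ltnS ?(leq_trans (ltnW m12)) //; case: (m) => -[].
rewrite /search_home /search_away /= mE inordK ?ltnS //.
have nodeh : t < size (route m) \/ node m t = h.
  case: (ltnP t (size (route m))); first by left.
  move=> szt; right; have -> : t = size (route m) by apply/eqP; rewrite eqn_leq tle.
  by rewrite -[RHS](route_last vm) (last_nth h).
case: ltnP nodeh => [tlt _|szt [|nodeh]] //.
  have ed : e (node m t) (node m t.+1).
    by have /(pathP h) := route_path vm; apply.
  by case: eqP => _; rewrite ed (conc_upd _ _ (a := Run m t true)).
by rewrite nodeh eqxx (encode_bdK okx) (conc_upd _ _ (a := Idle)).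
Qed.

Variable sch : scheduler k search.

Lemma run_conc c t :
  run e h b sch c t = conc (arun b c (scheduled e h b sch c) t).
Proof.
elim: t => [//|t IH]; rewrite /= -step_conc; last exact: wf_run.
rewrite -IH /run /scheduled /=; by case: (history e h b sch c t).
Qed.

Let sigma (c : coins k) := scheduled e h b sch c.

Lemma run_moves c t : moves (run e h b sch c t) <= 3 * pot (Bd 1 1 n n J) + k.
Proof. by rewrite run_conc; apply: mv_run. Qed.

Lemma run_reported (R : realType) (q : R) c : rho J + 2 <= k ->
  fair e h q b sch -> possible q c ->
  exists t i z, agent (run e h b sch c t) i = Reported _ z.
Proof.
move=> k_big fr pc.
have [i t|t [i [z iz]]] := @some_report k b b_h c (sigma c) k_big; last first.
  by exists t, i, (nth h vs z); rewrite run_conc /= iz.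
have [t' tt' H] := fr c pc i t; exists t' => //; case: H => H; [by left | right].
by move: H; rewrite run_conc /=; case: (ag _ i) => // m t0 [].
Qed.

Lemma run_correct (R : realType) (q : R) c : rho J + 2 <= k ->
  fair e h q b sch -> possible q c ->
  (forall t, honest b c (arun b c (sigma c) t)) ->
  correct e h b sch c.
Proof.
move=> k_big fr pc hon.
have only t i z : agent (run e h b sch c t) i = Reported _ z -> z = b.
  have [_ /(_ i)] := hon t; rewrite run_conc /=.
  case: (ag _ i) => //= [m u []|z'] //= -> [<-].
  by rewrite nth_index.
split=> //; have [t [i [z iz]]] := run_reported k_big fr pc.
by exists t, i; rewrite iz (only _ _ _ iz).
Qed.

Lemma mortal_honest c t : (forall i, mortal c i) -> honest b c (arun b c (sigma c) t).
Proof.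
move=> mort; elim: t => [|t IH]; first exact: honest_run0.
by apply: honest_step => //; apply: wf_run.
Qed.

(** The first agent to flip a coin does not depend on the coins, and as long as it is mortal
    [exclusive] prevents any other from flipping one. *)
Lemma exclusive_honest : J = 0 ->
  exists i0, forall c t, mortal c i0 -> honest b c (arun b c (sigma c) t).
Proof.
move=> J0; have [i0 i0P] := first_flipper e h b sch; exists i0 => c t mort.
suff [] : [/\ honest b c (arun b c (sigma c) t), exclusive b (arun b c (sigma c) t) &
  forall i, 0 < fl (arun b c (sigma c) t) i -> i = i0] by [].
elim: t => [|t [hon excl only]].
  by split=> //; exact: honest_run0.
have wfx := wf_run b_h c (sigma c) t.
have mort' j : 0 < fl (arun b c (sigma c) t) j -> mortal c j by move/only ->.
have excl' := @exclusive_step k b b_h c (sigma c t) _ J0 wfx hon mort' excl.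
split=> //; first exact: honest_step.
have flE u : fl (arun b c (sigma c) u) = flips (run e h b sch c u) by rewrite run_conc.
case: (pselect (exists j, 0 < fl (arun b c (sigma c) t) j)) => [[j jP] i iP|calm i iP].
  have <- : j = i0 by apply: only.
  apply: (@exclusive_flipper k b b_h _ i j (wf_run b_h c (sigma c) t.+1) excl' iP).
  rewrite flE; apply: leq_trans (_ : flips (run e h b sch c t) j <= _); first by rewrite -flE.
  by rewrite runS; apply: flips_step.
apply: (i0P c t); last by rewrite -flE.
move=> j; rewrite -flE; apply/eqP; rewrite -leqn0 leqNgt; apply/negP => jP.
by apply: calm; exists j.
Qed.

End Simulation.
End Protocol.

(** * Walks, dwelling at a node, and constrained distances *)

Section Walks.
Variables (T : finType) (e : rel T).
Hypothesis e_sym : symmetric e.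

Definition crossings (b x : T) (p : seq T) : nat :=
  count id (pairmap (fun y z => (y == b) || (z == b)) x p).

Lemma crossings_cat b x p q :
  crossings b x (p ++ q) = crossings b x p + crossings b (last x p) q.
Proof. by rewrite /crossings pairmap_cat count_cat. Qed.

Lemma crossings_iota b x p : crossings b x p =
  count (fun t => (nth x (x :: p) t == b) || (nth x (x :: p) t.+1 == b)) (iota 0 (size p)).
Proof.
transitivity (count id [seq (nth x (x :: p) t == b) || (nth x (x :: p) t.+1 == b)
    | t <- iota 0 (size p)]); last by rewrite count_map.
rewrite /crossings; congr count; apply: (@eq_from_nth _ false).
  by rewrite size_pairmap size_map size_iota.
move=> i; rewrite size_pairmap => ip.
by rewrite (nth_pairmap x) // (nth_map 0) ?size_iota // nth_iota.
Qed.

Lemma rev_path_sym x p : path e x p -> path e (last x p) (rev (belast x p)).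
Proof. by rewrite rev_path (@eq_path _ _ e) // => y z; apply: e_sym. Qed.

Lemma nth_belast (x0 x : T) p i : i < size p -> nth x0 (belast x p) i = nth x0 (x :: p) i.
Proof. by move=> ip; rewrite lastI nth_rcons size_belast ip. Qed.

Lemma last_rev_belast (x : T) p : last (last x p) (rev (belast x p)) = x.
Proof. by case: p => //= y p; rewrite rev_cons last_rcons. Qed.

Lemma walk_segment x0 W i j : sorted e W -> i < j -> j < size W ->
  exists q, [/\ path e (nth x0 W i) q, last (nth x0 W i) q = nth x0 W j,
    size q = j - i & forall t, t < j - i -> nth x0 q t = nth x0 W (i + t).+1].
Proof.
move=> /(sortedP x0) srt ij jW; exists (take (j - i) (drop i.+1 W)).
have szq : size (take (j - i) (drop i.+1 W)) = j - i.
  by rewrite size_takel // size_drop; lia.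
have nthq t : t < j - i -> nth x0 (take (j - i) (drop i.+1 W)) t = nth x0 W (i.+1 + t).
  by move=> tj; rewrite nth_take // nth_drop.
split=> //.
- apply/(pathP x0) => t; rewrite szq => tj; rewrite nthq //.
  case: t tj => [|t] tj /=; first by rewrite addn0; apply: srt; lia.
  rewrite nthq; last exact: ltnW.
  by rewrite addnS; apply: srt; lia.
rewrite (last_nth x0) szq; have : 0 < j - i by lia.
  case E: (j - i) => [//|d] _ /=; rewrite -E nthq; last by lia.
  by congr nth; lia.
Qed.

(** The walk goes back and forth over the link between [w] and [a]; each traversal is a crossing of
    [w]. *)
Lemma dwell (K : nat) a w : e a w ->
  exists q, [/\ path e w q, last w q = w, size q = 2 * K, crossings w w q = 2 * K &
    forall x, x \in q -> x = a \/ x = w].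
Proof.
move=> aw; elim: K => [|K [q [qp ql qs qc qin]]]; first by exists [::].
exists [:: a, w & q]; split=> //=.
- by rewrite e_sym aw.
- by rewrite qs; lia.
- by rewrite /crossings /= !eqxx orbT -[count _ _]/(crossings w w q) qc; lia.
- by move=> x; rewrite !inE => /or3P[/eqP->|/eqP->|/qin]; auto.
Qed.

(** A given path shortens to a duplicate-free one, of length below [#|T|], so [dist_through] does
    not take its default value. Shortening preserves [A] because the last node occurs only once on
    the new path. *)
Lemma dist_throughP (A : pred T) x y p :
  path e x p -> last x p = y -> all A (belast x p) ->
  exists q, [/\ path e x q, last x q = y, all A (belast x q) & size q = dist_through e A x y].
Proof.
move=> xp lp Ap.
pose Q d := [exists q : d.-tuple T, [&& path e x q, last x q == y & all A (belast x q)]].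
have hasQ : has Q (iota 0 #|T|).
  apply/hasP; case: (shortenP xp) (lp) => p' xp' up' sub lp'.
  exists (size p').
    by rewrite mem_iota /= add0n -[_.+1 <= _]/(size (x :: p') <= _) -(card_uniqP up') max_card.
  apply/existsP; exists (in_tuple p'); rewrite xp' lp' eqxx /=.
  apply/allP => z zp'; apply: (allP Ap).
  have : z \in x :: p.
    by have := mem_belast zp'; rewrite !inE => /orP[->//|/sub ->]; rewrite orbT.
  rewrite lastI mem_rcons inE => /orP[/eqP zl|//].
  move: up'; rewrite lastI rcons_uniq lp' => /andP[/negP[]].
  by rewrite -lp -zl.
have := nth_find 0 hasQ; rewrite nth_iota; last by rewrite -{2}(size_iota 0 #|T|) -has_find.
rewrite add0n => /existsP[q /and3P[xq /eqP lq Aq]].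
by exists q; rewrite size_tuple; split.
Qed.

(** The last link of [p] provides the neighbour to dwell with, and the one crossing beyond
    [2 * K]. *)
Lemma dwell_end (K : nat) x p w : path e x p -> last x p = w -> p != [::] ->
  exists p', [/\ path e x p', last x p' = w, size p' = size p + 2 * K,
    {subset p' <= x :: p} & (2 * K).+1 <= crossings w x p' /\
    forall b, crossings b x p <= crossings b x p'].
Proof.
case/lastP: p => [//|p0 w0]; rewrite last_rcons rcons_path => /andP[xp0 aw] w0w _.
move: aw; rewrite {}w0w => aw; have [q [qp ql qs qc qin]] := dwell K aw.
exists (rcons p0 w ++ q); split.
- by rewrite cat_path rcons_path xp0 aw last_rcons.
- by rewrite last_cat last_rcons.
- by rewrite size_cat qs.
- move=> y; rewrite mem_cat => /orP[yp|/qin[->|->]].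
  + by rewrite inE yp orbT.
  + by rewrite inE mem_rcons inE; have := mem_last x p0; rewrite inE => /orP[->|->]; rewrite ?orbT.
  + by rewrite inE mem_rcons mem_head orbT.
split; last by move=> b; rewrite crossings_cat leq_addr.
rewrite crossings_cat last_rcons qc -cats1 crossings_cat {2}/crossings /= eqxx orbT.
lia.
Qed.
End Walks.

(** * Closed routes exploring an interval, for one direction of the order *)

Section Explore.
Variables (T : finType) (e : rel T) (h : T) (vs W : seq T) (r K : nat).
Hypothesis e_sym : symmetric e.
Hypothesis vs_uniq : uniq vs.
Hypothesis vs_all : forall x, x \in vs.
Hypothesis vs_h : index h vs = 0.
Hypothesis W_walk : sorted e W.
Hypothesis W_start : ohead W = Some h.
Hypothesis W_all : forall x, x \in W.
Hypothesis W_order : forall x y, index x vs < index y vs -> index x W < index y W.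
Hypothesis r_dist : forall w, w != h ->
  dist_through e (fun x => (x == h) || (index x vs < index w vs)) h w <= r.

Let n := size vs.
Let u := nth h vs.
Let f i := index (u i) W.

Lemma W_before i t : i < n -> t < f i -> index (nth h W t) vs < i.
Proof.
move=> iN tf; have tW : t < size W by apply: ltn_trans tf _; rewrite index_mem.
have ui : index (u i) vs = i by rewrite index_uniq.
rewrite ltnNge leq_eqVlt; apply/negP => /orP[/eqP E|lt].
  have E' : nth h W t = u i by rewrite /u E nth_index.
  by have := index_nth h tW; rewrite E' leqNgt tf.
have := @W_order (u i) (nth h W t); rewrite ui => /(_ lt) /leq_trans/(_ (index_nth h tW)).
by rewrite -/(f i) => /ltn_trans/(_ tf); rewrite ltnn.
Qed.

Lemma f_mono i : i.+1 < n -> f i < f i.+1.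
Proof. by move=> iN; apply: W_order; rewrite !index_uniq // ltnW. Qed.

Lemma f_gt0 i : 0 < i < n -> 0 < f i.
Proof.
move=> /andP[i0 iN]; apply: leq_ltn_trans (leq0n (index h W)) _.
by apply: W_order; rewrite vs_h index_uniq.
Qed.

(** The part of [W] before its first visit to [u i] uses only earlier nodes, so the constrained
    distance is realised by a path, of length at most [r]. *)
Lemma approach i : 0 < i < n ->
  exists q, [/\ path e h q, last h q = u i, q != [::],
    all (fun x => index x vs <= i) q & size q <= r].
Proof.
move=> /andP[i0 iN]; have f0 : 0 < f i by apply: f_gt0; rewrite i0.
have W0 : nth h W 0 = h by case: (W) W_start => //= x W' [].
have fW : f i < size W by rewrite index_mem.
have ui : index (u i) vs = i by rewrite index_uniq.
have uh : u i != h by apply/eqP => E; move: ui i0; rewrite E vs_h => <-.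
have [q []] := walk_segment h W_walk f0 fW; rewrite W0 subn0 nth_index // => hq lq sq nthq.
have [|q' [hq' lq' Aq' sq']] := dist_throughP
    (A := fun x => (x == h) || (index x vs < index (u i) vs)) hq lq.
  apply/allP => x /(nthP h)[t]; rewrite size_belast => tq <-.
  rewrite nth_belast // ui; case: t tq => [|t] tq /=; first by rewrite eqxx.
  have tf : t.+1 < f i by rewrite -[f i]sq.
  by rewrite nthq ?(ltnW tf) // add0n W_before ?orbT.
exists q'; split=> //.
- by case: q' lq' {hq' Aq' sq'} => //= E; rewrite -E eqxx in uh.
- apply/allP => x xq'; have : x \in h :: q' by rewrite inE xq' orbT.
  rewrite lastI mem_rcons inE lq' => /orP[/eqP->|/(allP Aq')]; first by rewrite ui.
  by rewrite ui => /orP[/eqP->|/ltnW //]; rewrite vs_h.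
- by rewrite sq' r_dist.
Qed.

(** From one new node to the next the route follows [W], which passes only through earlier nodes,
    and then dwells; the differences of [f] telescope. *)
Lemma explore_to x d : 0 < x -> x + d < n ->
  exists p, [/\ path e h p, last h p = u (x + d),
    all (fun a => index a vs <= x + d) p, size p <= r + (f (x + d) - f x) + 2 * K * d.+1 &
    forall i, x <= i <= x + d -> (2 * K).+1 <= crossings (u i) h p].
Proof.
move=> x0; elim: d => [|d IH] xd.
  rewrite addn0 in xd *; have [|q [hq lq q0 Aq sq]] := @approach x; first by rewrite x0.
  have [p [hp lp sp sub [cr _]]] := dwell_end e_sym K hq lq q0.
  exists p; split=> //.
  - apply/allP => a /sub; rewrite inE => /orP[/eqP->|/(allP Aq)//].
    by rewrite vs_h.
  - by rewrite sp subnn addn0 muln1 leq_add2r.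
  - by move=> i; rewrite -eqn_leq => /eqP <-.
have [|p [hp lp Ap sp crp]] := IH; first by lia.
have xd' : (x + d).+1 < n by rewrite -addnS.
have fd : f (x + d) < f (x + d.+1) by rewrite addnS; apply: f_mono.
have fW : f (x + d.+1) < size W by rewrite index_mem.
have ui : index (u (x + d.+1)) vs = x + d.+1 by rewrite index_uniq.
have [q []] := walk_segment h W_walk fd fW; rewrite !nth_index // => pq lq sq nthq.
have pq0 : p ++ q != [::] by rewrite -size_eq0 size_cat sq; lia.
have [|| p' [hp' lp' sp' sub [cr mono]]] := dwell_end e_sym K _ _ pq0 (x := h) (w := u (x + d.+1)).
- by rewrite cat_path hp lp.
- by rewrite last_cat lp.
exists p'; split=> //.
- apply/allP => a /sub; rewrite inE mem_cat => /or3P[/eqP->|/(allP Ap)|].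
  + by rewrite vs_h.
  + by move/leq_trans; apply; rewrite leq_add2l.
  move=> /(nthP h)[t]; rewrite sq => tq <-; rewrite nthq //.
  have : (f (x + d) + t).+1 <= f (x + d.+1) by move: tq; rewrite ltn_subRL.
  rewrite leq_eqVlt => /orP[/eqP->|lt]; first by rewrite nth_index // ui.
  by apply: ltnW; apply: W_before.
- rewrite sp' size_cat sq.
  have fx : f x <= f (x + d).
    clear -x0 xd W_order vs_uniq; elim: d xd => [|d IH] xd; first by rewrite addn0.
    apply: leq_trans (IH _) _; first by lia.
    by rewrite [x + d.+1]addnS; apply/ltnW/f_mono; lia.
  have -> : 2 * K * d.+2 = 2 * K * d.+1 + 2 * K by rewrite mulnSr.
  by clear -sp fx fd; lia.
- move=> i /andP[xi]; rewrite leq_eqVlt => /orP[/eqP->//|]; rewrite addnS ltnS => id.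
  apply: leq_trans (mono _); rewrite crossings_cat; apply: leq_trans (leq_addr _ _).
  by apply: crp; rewrite xi.
Qed.

(** The return reverses a short approach to the last node. One [r] is for the approach to [x], one
    for the stretch of [W] by [fr], one for the return. *)
Lemma explore x y : 0 < x -> x < y -> y <= n -> f y.-1 <= f x + r ->
  exists p, [/\ path e h p, last h p = h, all (fun a => index a vs < y) p,
    size p <= 3 * r + 2 * K * (y - x) &
    forall i, x <= i < y -> (2 * K).+1 <= crossings (u i) h p].
Proof.
move=> x0 xy yn fr; have yE : x + (y.-1 - x) = y.-1 by lia.
have [|p [hp lp Ap sp crp]] := @explore_to x (y.-1 - x) x0; first by lia.
rewrite {}yE in lp Ap sp crp.
have [|q [hq lq _ Aq sq]] := @approach y.-1; first by lia.
exists (p ++ rev (belast h q)); split.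
- by rewrite cat_path hp lp -lq rev_path_sym.
- by rewrite last_cat lp -lq last_rev_belast.
- rewrite all_cat all_rev; apply/andP; split; apply/allP => a.
    by move=> /(allP Ap); lia.
  move=> /mem_belast; rewrite inE => /orP[/eqP->|/(allP Aq)]; last by lia.
  by rewrite vs_h; lia.
- rewrite size_cat size_rev size_belast; move: sp; have -> : (y.-1 - x).+1 = y - x by lia.
  by move: (2 * K * (y - x)) => z; lia.
- move=> i ixy; rewrite crossings_cat; apply: leq_trans (leq_addr _ _).
  by apply: crp; lia.
Qed.
End Explore.

(** * Probability of failure under independent coins *)

Section CoinProb.
Import Order.TTheory GRing.Theory Num.Theory.
Local Open Scope ring_scope.
Variables (R : realType) (k N : nat) (q : R).
Hypothesis q01 : 0 < q <= 1.

Let weight (f : {ffun 'I_k * 'I_N -> bool}) : R :=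
  \prod_(a : 'I_k * 'I_N) (if f a then q else 1 - q).

Let q_ge0 : 0 <= q. Proof. by case/andP: q01 => /ltW. Qed.
Let q_le1 : 0 <= 1 - q. Proof. by rewrite subr_ge0; case/andP: q01. Qed.

Lemma weight_ge0 f : 0 <= weight f.
Proof. by apply: prodr_ge0 => a _; case: ifP. Qed.

Lemma weight_impossible f : ~ possible q (coins_of f) -> weight f = 0.
Proof.
move=> imp; have [i [j [fij nq]]] : exists i j, coins_of f i j = false /\ ~ q < 1.
  apply: contrapT => H; apply: imp => i j fij; apply: contrapT => nq.
  by apply: H; exists i, j.
have q1 : q = 1.
  by apply/eqP; case/andP: q01 => _ q1; rewrite eq_le q1 /= leNgt; apply/negP.
move: fij; rewrite /coins_of; case: insubP => // j' _ _ fij.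
by rewrite /weight (bigD1 (i, j')) //= fij q1 subrr mul0r.
Qed.

(** The event constrains each coin separately, so the sum of products is a product of sums; a coin
    left free contributes [q + (1 - q) = 1]. *)
Lemma weight_free (i : 'I_k) (m : nat) : (m <= N)%N ->
  \sum_(f : {ffun 'I_k * 'I_N -> bool} | [forall j : 'I_N, (j < m)%N ==> ~~ f (i, j)]) weight f
  = (1 - q) ^+ m.
Proof.
move=> mN.
pose Q (a : 'I_k * 'I_N) : pred bool := fun v => ((a.1 == i) && (a.2 < m)%N) ==> ~~ v.
transitivity (\sum_(f in family Q) weight f).
  apply: eq_bigl => f; apply/forallP/familyP => [H [i' j]|H j].
    by rewrite unfold_in /Q /=; case: eqP => //= ->; apply: H.
  by have := H (i, j); rewrite unfold_in /Q /= eqxx.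
rewrite /weight -(bigA_distr_big_dep Q (fun _ v => if v then q else 1 - q)).
transitivity (\prod_(a : 'I_k * 'I_N) (if (a.1 == i) && (a.2 < m)%N then 1 - q else 1)).
  apply: eq_bigr => a _; rewrite big_mkcond big_bool /Q /=.
  case: (_ && _) => /=; [by rewrite add0r | by rewrite addrC subrK].
rewrite -(pair_bigA _ (fun i' (j : 'I_N) => if (i' == i) && (j < m)%N then 1 - q else 1)) /=.
rewrite (bigD1 i) //= [X in _ * X]big1 ?mulr1; last first.
  by move=> i' /negbTE ii'; rewrite big1 // => j _; rewrite ii'.
rewrite -big_mkcond; under eq_bigl do rewrite eqxx /=.
by rewrite -(big_ord_widen _ (fun _ => 1 - q) mN) prodr_const card_ord.
Qed.

Lemma weight_total : (0 < k)%N -> \sum_f weight f = 1.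
Proof.
move=> k0; rewrite -[RHS](expr0 (1 - q)) -(weight_free (Ordinal k0) (leq0n N)).
by apply: eq_bigl => f; apply/esym/forallP.
Qed.

(* Coins beyond the first [N] kill, so that a run of [m > N] harmless coins is
   impossible. *)
Lemma weight_false (i : 'I_k) (m : nat) :
  \sum_(f : {ffun 'I_k * 'I_N -> bool} | [forall j : 'I_m, ~~ coins_of f i j]) weight f
  <= (1 - q) ^+ m.
Proof.
case: (leqP m N) => [mN|Nm]; last first.
  rewrite big_pred0 ?exprn_ge0 // => f; apply/negP => /forallP/(_ (Ordinal Nm)).
  by rewrite /coins_of insubF //= ltnn.
rewrite -(weight_free i mN) le_eqVlt; apply/orP; left; apply/eqP.
apply: eq_bigl => f; apply/forallP/forallP => H j.
  apply/implyP => jm; have := H (Ordinal jm).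
  by rewrite /coins_of insubT //= => jN; congr (~~ f (i, _)); apply: val_inj.
rewrite /coins_of; have jN := leq_trans (ltn_ord j) mN.
rewrite insubT //=; by have := H (Ordinal jN); rewrite /= ltn_ord.
Qed.

(** Union bound over [S]. Impossible outcomes have weight zero, so [HE] may be restricted to
    possible ones. *)
Lemma coin_prob_union (E : coins k -> Prop) (S : {set 'I_k}) (m : nat) :
  (forall c, possible q c -> (forall i, i \in S -> exists2 j, (j < m)%N & c i j) -> ~ E c) ->
  coin_prob q N E <= #|S|%:R * (1 - q) ^+ m.
Proof.
move=> HE; rewrite /coin_prob.
pose bad i (f : {ffun 'I_k * 'I_N -> bool}) := [forall j : 'I_m, ~~ coins_of f i j].
apply: (@le_trans _ _ (\sum_f \sum_(i in S) if bad i f then weight f else 0)); last first.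
  rewrite exchange_big /= mulr_natl -sumr_const; apply: ler_sum => i _.
  by rewrite -big_mkcond; apply: weight_false.
rewrite big_mkcond; apply: ler_sum => f _.
have pos i : 0 <= (if bad i f then weight f else 0) by case: ifP => // _; apply: weight_ge0.
case: ifP => [/asboolP Ef|_]; last by apply: sumr_ge0.
case: (pselect (possible q (coins_of f))) => [pf|/weight_impossible w0]; last first.
  by rewrite -/(weight f) w0; apply: sumr_ge0 => i _; case: ifP => // _; rewrite w0.
have [i iS badi] : exists2 i, i \in S & bad i f.
  apply: contrapT => H; apply: HE pf _ Ef => i iS; apply: contrapT => H'.
  apply: H; exists i => //; apply/forallP => j; apply/negP => cj.
  by apply: H'; exists j.
by rewrite (bigD1 i) //= badi lerDl sumr_ge0.
Qed.

(** The outcome in which every coin kills has positive weight and lies outside [E]. This settles the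
    case [delta = 1]. *)
Lemma coin_prob_lt1 (E : coins k -> Prop) : (0 < k)%N ->
  ~ E (fun _ _ => true) -> coin_prob q N E < 1.
Proof.
move=> k0 nE; rewrite /coin_prob -[X in _ < X](weight_total k0).
pose f1 : {ffun 'I_k * 'I_N -> bool} := [ffun _ => true].
have nf1 : ~~ `[< E (coins_of f1) >].
  apply/asboolP => H; apply: nE.
  suff <- : coins_of f1 = (fun _ _ => true) by [].
  by apply/funext => i; apply/funext => j; rewrite /coins_of; case: insub => // j'; rewrite ffunE.
rewrite [X in _ < X](bigID (fun f => `[< E (coins_of f) >])) /= ltrDl.
rewrite (bigD1 f1) //= ltr_pwDl //; last by apply: sumr_ge0 => f _; apply: weight_ge0.
by apply: prodr_gt0 => a _; rewrite ffunE; case/andP: q01.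
Qed.
End CoinProb.

(** * Routes and weights obtained from the traversal pair *)

Section Instance.
Variables (T : finType) (e : rel T) (h v : T) (vs wl wr : seq T).
Hypothesis net : network e.
Hypothesis e_hv : e h v.
Hypothesis pair : traversal_pair e h v vs wl wr.

Let n := size vs.
Let r := tp_radius e h vs.
Let s := tp_size wl wr.

Lemma size_vs : n = #|T|.
Proof.
have [vsu vsa _ _ _ _ _ _ _ _ _ _] := pair.
rewrite /n cardE; apply/perm_size/uniq_perm; rewrite ?enum_uniq // => x.
by rewrite mem_enum vsa.
Qed.

Lemma vs_cons : vs = h :: behead vs.
Proof. by case: pair => _ _ + _ _ _ _ _ _ _ _ _; case: (vs) => //= x t [->]. Qed.

Lemma index_h : index h vs = 0.
Proof. by rewrite vs_cons /= eqxx. Qed.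

Lemma index_nth_vs i : i < n -> index (nth h vs i) vs = i.
Proof. by move=> iN; rewrite index_uniq //; case: pair. Qed.

Lemma nth_neq_h i : 0 < i < n -> nth h vs i != h.
Proof.
move=> /andP[i0 iN]; apply/eqP => E; have := index_nth_vs iN.
by rewrite E index_h => i0'; rewrite -i0' in i0.
Qed.

Lemma n_gt1 : 1 < n.
Proof.
have [_ irr _] := net; have [_ vsa _ _ _ _ _ _ _ _ _ _] := pair.
have hv : h != v by apply/eqP => E; move: e_hv; rewrite -E irr.
rewrite -(size_iota 0 n); have : 1 <= index v vs.
  rewrite lt0n; apply/eqP => v0; move: hv.
  by rewrite -{1}(nth_index h (vsa v)) v0 -index_h nth_index ?vsa // eqxx.
by rewrite size_iota => /leq_ltn_trans; apply; rewrite index_mem.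
Qed.

Lemma dist_gt0 (A : pred T) x y : x != y -> 0 < dist_through e A x y.
Proof.
move=> /negbTE xy; rewrite /dist_through; case E: #|T| => [|m] /=.
  by have := fintype0 x E.
case: existsP => // -[q /and3P[_ + _]]; by rewrite tuple0 /= xy.
Qed.

Lemma r_left_le w : r_left e h vs w <= r.
Proof.
exact: leq_trans (leq_maxl _ _)
  (leq_bigmax (F := fun w => maxn (r_left e h vs w) (r_right e h vs w)) w).
Qed.

Lemma r_right_le w : r_right e h vs w <= r.
Proof.
exact: leq_trans (leq_maxr _ _)
  (leq_bigmax (F := fun w => maxn (r_left e h vs w) (r_right e h vs w)) w).
Qed.

Lemma r_gt0 : 0 < r.
Proof.
have [_ irr _] := net.
have hv : h != v by apply/eqP => E; move: e_hv; rewrite -E irr.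
exact: leq_trans (dist_gt0 _ hv) (r_left_le v).
Qed.

Lemma r_le_n : r <= n.
Proof.
have dist_le A y : dist_through e A h y <= #|T|.
  by rewrite /dist_through -[X in _ <= X](size_iota 0) find_size.
by rewrite size_vs; apply/bigmax_leqP => w _; rewrite geq_max !dist_le.
Qed.

(* |pi_l[v_1, v_i]| + |pi_r[v_1, v_i]|, up to a constant. *)
Definition travel (i : nat) : nat :=
  index (nth h vs i) wl + (size wr - index (nth h vs i) wr).

Lemma index_wl_mono i j : i < j -> j < n -> index (nth h vs i) wl < index (nth h vs j) wl.
Proof.
move=> ij jN; have [_ _ _ _ _ _ _ lo _ _ _ _] := pair.
by apply: lo; rewrite !index_nth_vs //; apply: ltn_trans jN.
Qed.

Lemma index_wr_mono i j : i < j -> j < n -> index (nth h vs j) wr < index (nth h vs i) wr.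
Proof.
move=> ij jN; have [_ _ _ _ _ _ _ _ _ _ _ ro] := pair.
by apply: ro; rewrite !index_nth_vs //; apply: ltn_trans jN.
Qed.

Lemma index_wl_lt x : index x wl < size wl.
Proof. by rewrite index_mem; case: pair. Qed.

Lemma index_wr_lt x : index x wr < size wr.
Proof. by rewrite index_mem; case: pair. Qed.

Lemma travel_mono i : i.+1 < n -> travel i < travel i.+1.
Proof.
move=> iN; rewrite /travel; have := index_wl_mono (ltnSn i) iN.
have := index_wr_mono (ltnSn i) iN; have := index_wr_lt (nth h vs i); lia.
Qed.

Lemma travel_le : travel n.-1 - travel 1 <= 2 * s.
Proof.
have := index_wl_lt (nth h vs n.-1); have := index_wr_lt (nth h vs 1).
have := index_wr_lt (nth h vs n.-1).
rewrite /s /tp_size /walk_length /travel; lia.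
Qed.

(* The order in which h followed by pi_r explores the nodes. *)
Definition reversed : seq T := h :: rev (behead vs).

Lemma index_reversed x : x != h -> index x reversed = n - index x vs.
Proof.
move=> xh; have [vsu vsa _ _ _ _ _ _ _ _ _ _] := pair.
have := vsa x; have := vsu; rewrite /n vs_cons /reversed /= eq_sym (negbTE xh).
move: (behead vs) => t /andP[_ ut]; rewrite inE (negbTE xh) /= => xt.
have lt : index x t < size t by rewrite index_mem.
have lt' : size t - (index x t).+1 < size t.
  by rewrite ltn_subrL (leq_ltn_trans _ lt).
have := @index_uniq _ h (size t - (index x t).+1) (rev t); rewrite size_rev rev_uniq.
rewrite nth_rev // subnSK // subKn ?(ltnW lt) // nth_index // => -> //.
- by rewrite subSS subnSK.
- exact: leq_subr.
Qed.

Lemma index_h_reversed : index h reversed = 0.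
Proof. by rewrite /= eqxx. Qed.

Lemma nth_reversed i : 0 < i < n -> nth h reversed (n - i) = nth h vs i.
Proof.
move=> iN; have [vsu vsa _ _ _ _ _ _ _ _ _ _] := pair.
have i_lt : i < n by case/andP: iN.
rewrite -[RHS](nth_index h (s := reversed)); last first.
  by rewrite inE mem_rev -in_cons -vs_cons vsa.
by rewrite index_reversed ?nth_neq_h // index_nth_vs.
Qed.

Section Search.
Variables (nxt Fut rho : nat -> nat) (J K : nat).
Hypothesis r_le_J : r <= 2 ^ J.
Hypothesis J_le_r : J <= r.
Hypothesis nxt_lt : forall j, 0 < j -> nxt j < j.
Hypothesis rho_nxt : forall j, 0 < j -> rho (nxt j) < rho j.
Hypothesis Fut_nxt : forall j, 0 < j -> j <= J ->
  4 * r * 2 ^ (j - nxt j) + 2 * K * 2 ^ j + Fut (nxt j) <= Fut j.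

Definition routing (m : mission) (p : seq T) : Prop :=
  [/\ path e h p, last h p = h, size p <= cost r K m,
    forall i, between m i -> (2 * K).+1 <= crossings (nth h vs i) h p &
    forall a, a \in p -> a = h \/ reach m (index a vs)].

(** Left missions use [wl] itself. For right missions the order is reversed, [wr] is prefixed with
    [h], a neighbour of its start, and [x, y) becomes [n + 1 - y, n + 1 - x). *)
Lemma routing_exists m : valid vs travel r m -> exists p, routing m p.
Proof.
have [e_sym _ _] := net.
have [vsu vsa _ _ wls wl0 wla lorder wrs wr0 wra rorder] := pair.
case: m => -[[] x] y /and4P[/= x0 xy yn xyr].
- have [|p [hp lp Ap sp crp]] := @explore T e h vs wl r K e_sym vsu vsa index_h wls wl0 wla
    lorder (fun w _ => r_left_le w) x y x0 xy yn.
    (* Both parts of [travel] increase along the order, so a bound on its growth bounds the part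
       along [wl]. *)
    have := index_wl_lt (nth h vs x); move: xyr; rewrite /travel.
    case: (ltnP x y.-1) => [lt|ge]; last by have -> : y.-1 = x by [lia]; lia.
    have := index_wr_mono lt; have := index_wr_lt (nth h vs x); lia.
  exists p; split=> // a /(allP Ap) ay; by right.
have wr'_walk : sorted e (h :: wr).
  by case: (wr) wr0 wrs => //= z t [->]; rewrite e_hv.
have order' a b : index a reversed < index b reversed -> index a (h :: wr) < index b (h :: wr).
  case: (eqVneq b h) => [->|bh]; first by rewrite index_h_reversed.
  case: (eqVneq a h) => [->|ah]; first by rewrite /= eqxx eq_sym (negbTE bh).
  rewrite !index_reversed //= ![h == _]eq_sym (negbTE ah) (negbTE bh) ltnS => ab.
  apply: rorder; lia.
(* The nodes that precede [w] in the reversed order are [h] and those that follow [w] in [vs], so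
   this distance is [r_right]. *)
have dist' w : w != h ->
    dist_through e (fun x => (x == h) || (index x reversed < index w reversed)) h w <= r.
  move=> wh; apply: leq_trans (r_right_le w); rewrite leq_eqVlt; apply/orP; left.
  rewrite /r_right; apply/eqP; congr dist_through; apply/funext => a.
  case: (eqVneq a h) => [//|ah]; rewrite !orFb !index_reversed //.
  have : index a vs < n by rewrite index_mem.
  have : index w vs < n by rewrite index_mem.
  lia.
have size' : size reversed = n by rewrite /reversed /= size_rev /n {2}vs_cons.
have uniq' : uniq reversed by move: vsu; rewrite vs_cons /= rev_uniq mem_rev.
have all' a : a \in reversed by have := vsa a; rewrite {1}vs_cons !inE mem_rev.
have nthr i : x <= i < y -> nth h reversed (n - i) = nth h vs i.
  by move=> ixy; apply: nth_reversed; lia.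
have [|||||p [hp lp Ap sp crp]] := @explore T e h reversed (h :: wr) r K e_sym uniq' all'
    index_h_reversed wr'_walk erefl _ order' dist' (n.+1 - y) (n.+1 - x).
- by move=> a; rewrite inE wra orbT.
- lia.
- lia.
- by rewrite size'; lia.
- have -> : (n.+1 - x).-1 = n - x by lia.
  have -> : n.+1 - y = n - y.-1 by lia.
  rewrite !nthr; try lia.
  rewrite /= ![h == _]eq_sym !(negbTE (nth_neq_h _)); try lia.
  have := index_wr_lt (nth h vs x); have := index_wr_lt (nth h vs y.-1).
  move: xyr; rewrite /travel.
  case: (ltnP x y.-1) => [lt|ge]; last by have -> : y.-1 = x by [lia]; lia.
  have := index_wl_mono lt; lia.
exists p; split=> //.
- apply: leq_trans sp _; rewrite /cost /= leq_add2l leq_mul2l; apply/orP; right; lia.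
- move=> i /andP[/= xi iy]; rewrite -nthr ?xi //; apply: crp; lia.
move=> a ap; case: (eqVneq a h) => [->|ah]; [by left | right].
have := allP Ap _ ap; rewrite index_reversed // /reach /=.
have : index a vs < n by rewrite index_mem.
lia.
Qed.

(** The exponent 10 is 8 for the positions and 2 for the level, as [J.+1 <= n.+1 <= n ^ 2]. The move
    bound is three times the initial potential plus one unit of [work] per agent. *)
Lemma search_protocol : exists P : protocol T, small_board P 10 /\
  forall (k : nat) (b : T) (sch : scheduler k P) (R : realType) (q : R),
  rho J + 2 <= k -> b != h -> fair e h q b sch ->
  [/\ forall c t, moves (run e h b sch c t) <= 3 * (4 * (2 * s + r) + 2 * K * n + Fut J) + k,
      forall c, possible q c -> exists t i z, agent (run e h b sch c t) i = Reported _ z,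
      forall c, possible q c -> (forall i, exists2 j, j <= 2 * K & c i j) ->
        correct e h b sch c &
      J = 0 -> exists i0, forall c, possible q c -> (exists2 j, j <= 2 * K & c i0 j) ->
        correct e h b sch c].
Proof.
have [e_sym _ _] := net.
have [vsu vsa _ _ wls wl0 wla lorder wrs wr0 wra rorder] := pair.
have /choice[route routeP] : forall m, exists p, valid vs travel r m -> routing m p.
  move=> m; case: (boolP (valid vs travel r m)) => vm; last by exists [::].
  by have [p pP] := routing_exists vm; exists p.
have rpath m : valid vs travel r m -> path e h (route m) by case/routeP.
have rlast m : valid vs travel r m -> last h (route m) = h by case/routeP.
have rsize m : valid vs travel r m -> size (route m) <= cost r K m by case/routeP.
have rcross m i : valid vs travel r m -> between m i ->
    (2 * K).+1 <= count (crossing h route (nth h vs i) m) (iota 0 (size (route m))).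
  by case/routeP => _ _ _ cr _ /cr; rewrite crossings_iota.
have rreach m t : valid vs travel r m ->
    node h route m t = h \/ reach m (index (node h route m t) vs).
  case/routeP => _ _ _ _ re; rewrite /node.
  case: (ltnP t (size (h :: route m))) => [/(mem_nth h)|/(nth_default h)->]; last by left.
  by rewrite inE => /orP[/eqP->|/re//]; left.
exists (search h vs travel nxt r J K route); split.
  apply: (@search_board_size T h vs travel nxt r J K route vsu vsa n_gt1 2).
  apply: leq_trans (_ : n.+1 <= _); first by rewrite ltnS (leq_trans J_le_r) ?r_le_n.
  rewrite -mulnn; apply: leq_trans (leq_mul n_gt1 (leqnn n)).
  by rewrite mul2n -addnn -addn1 leq_add2l ltnW ?n_gt1.
move=> k b sch R q k_big bh fr; have n1 := n_gt1; have r0 := r_gt0.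
have correct' c pc := @run_correct _ _ _ _ _ _ _ _ _ _ _ _ vsu vsa index_h n1 r0 travel_mono
  r_le_J nxt_lt rho_nxt Fut_nxt rpath rlast rsize rreach k b bh sch R q c k_big fr pc.
split.
- move=> c t; apply: leq_trans (run_moves vsu index_h n1 r0 travel_mono r_le_J nxt_lt
    rho_nxt Fut_nxt rpath rlast rsize rreach bh sch c t) _.
  rewrite leq_add2r leq_mul2l /=; apply/leq_add => //; rewrite /middle eqxx n1.
  apply: leq_add; last by rewrite leq_mul2l leq_subr orbT.
  by rewrite leq_mul2l leq_add2r travel_le.
- move=> c; exact: (run_reported vsu index_h n1 r0 travel_mono r_le_J nxt_lt
    rho_nxt Fut_nxt rpath rlast rsize rreach bh k_big fr).
- move=> c pc mort; apply: (correct' c pc) => t.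
  exact: (mortal_honest e vsu vsa index_h n1 r0 travel_mono r_le_J nxt_lt
    rho_nxt Fut_nxt rcross rreach bh sch t mort).
- move=> J0; have [i0 i0P] := exclusive_honest vsu vsa index_h n1 r0 travel_mono r_le_J nxt_lt
    rho_nxt Fut_nxt rpath rlast rsize rcross rreach bh sch J0.
  by exists i0 => c pc mort; apply: (correct' c pc) => t; apply: i0P.
Qed.
End Search.
End Instance.

(** * Logarithms and numerical estimates of the failure probability *)

Section Bounds.
Import Order.TTheory GRing.Theory Num.Theory.

Lemma up_log2_double_bound (r : nat) : 0 < r -> 2 ^ up_log 2 r <= 2 * r.
Proof.
move=> r0; have [r1|r1] := leqP r 1.
  have -> : r = 1 by lia.
  by rewrite up_log1.
have := up_log_gtn (p := 2) isT r1; have J0 : 0 < up_log 2 r by rewrite up_log_gt0.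
by rewrite -[X in _ -> 2 ^ X <= _](prednK J0) expnS leq_mul2l /= => /ltnW.
Qed.

Lemma up_log2_le (r : nat) : up_log 2 r <= r.
Proof. by apply: up_log_min => //; apply: ltnW; apply: ltn_expl. Qed.

Local Open Scope ring_scope.
Variable R : realType.
Implicit Types p q x : R.

Lemma Delta_spec p x : 0 < p < 1 -> 0 < x <= 1 -> (1 - p) ^+ Delta p x <= x.
Proof.
move=> /andP[p0 p1] /andP[x0 x1]; rewrite /Delta lt_eqF // /nat_ceil.
have p1' : 0 < 1 - p by rewrite subr_gt0.
have lnp : ln (1 - p) < 0 by apply: ln_lt0; rewrite p1' gtrBl.
set t := ln x / ln (1 - p); have t0 : 0 <= t.
  by rewrite /t mulr_le0 ?ln_le0 // invr_le0 ltW.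
have ce : t <= `|Num.ceil t|%N%:R.
  apply: le_trans (ceil_ge t) _; by rewrite natr_absz ler_int ler_norm.
rewrite -ler_ln ?posrE ?exprn_gt0 // lnXn // -mulr_natl -ler_ndivrMr //.
Qed.

Lemma log2_up_log (r : nat) : (0 < r)%N ->
  (up_log 2 r)%:R - 1 < log2 (r%:R : R) <= (up_log 2 r)%:R.
Proof.
move=> r0; have ln2 : 0 < ln (2 : R) by apply: ln_gt0; lra.
have rR : 0 < r%:R :> R by rewrite ltr0n.
apply/andP; split; last first.
  rewrite /log2 ler_pdivrMr // mulr_natl -lnXn; last by lra.
  by rewrite ler_ln ?posrE ?exprn_gt0 // ?ltr0n // -natrX ler_nat up_logP.
have [r1|r1] := leqP r 1%N.
  have -> : r = 1%N by lia.
  by rewrite up_log1 /log2 ln1 mul0r; lra.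
have J0 : (0 < up_log 2 r)%N by rewrite up_log_gt0.
rewrite -{1}(prednK J0) -natr1 addrK /log2 ltr_pdivlMr // mulr_natl -lnXn; last by lra.
by rewrite ltr_ln ?posrE ?exprn_gt0 // ?ltr0n // -natrX ltr_nat up_log_gtn.
Qed.

Lemma nat_ceil_log2 (r : nat) : (0 < r)%N ->
  nat_ceil (log2 (r%:R : R) + 2) = (up_log 2 r + 2)%N.
Proof.
move=> /log2_up_log /andP[lo hi]; rewrite /nat_ceil.
rewrite (@ceil_def _ _ (up_log 2 r + 2)%:Z) //.
by rewrite rmorphB /= -pmulrn natrD; apply/andP; split; lra.
Qed.

(** The odd crossing is kept apart as the factor [1 - p]: it makes the failure bounds below
    strict. *)
Lemma kill_power p q x (C D : nat) : 0 < p <= q -> q <= 1 -> p < 1 -> (1 - p) ^+ D <= x ->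
  (1 - q) ^+ (2 * (C * D)).+1 <= (1 - p) * x ^+ (2 * C).
Proof.
move=> /andP[p0 pq] q1 p1 px.
apply: (@le_trans _ _ ((1 - p) ^+ (2 * (C * D)).+1)).
  by apply: lerXn2r; rewrite ?nnegrE ?subr_ge0 ?(le_trans pq) // lerD2l lerN2.
rewrite exprS ler_pM2l ?subr_gt0 // mulnA mulnC exprM.
have x0 : 0 <= (1 - p) ^+ D by rewrite exprn_ge0 // subr_ge0 ltW.
by apply: lerXn2r; rewrite ?nnegrE ?(le_trans x0).
Qed.

(** Of the [2 * M.+1] factors [delta], one is kept, [M] yield [1 / 3] and so cancel the number of
    agents, and the others are at most 1. *)
Lemma failure_reused p q delta d (M : nat) :
  0 < p <= q -> q <= 1 -> 0 < delta <= 1 -> delta <= d -> d ^+ M <= 1 / 3 ->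
  3 * (1 - q) ^+ (2 * (M.+1 * Delta p delta)).+1 < delta.
Proof.
move=> /andP[p0 pq] q1 /andP[de0 de1] de_d dM.
have [pE|p_neq1] := eqVneq p 1.
  have -> : q = 1 by apply/eqP; rewrite eq_le q1 -pE.
  by rewrite subrr expr0n /= mulr0.
have p_lt1 : p < 1 by rewrite lt_neqAle p_neq1 (le_trans pq).
have px : (1 - p) ^+ Delta p delta <= delta.
  by apply: Delta_spec; rewrite ?p0 ?de0.
have kp := kill_power M.+1 (introT andP (conj p0 pq)) q1 p_lt1 px.
have dM' : delta ^+ (2 * M.+1) <= 1 / 3 * delta.
  have -> : (2 * M.+1 = M.+1 + M + 1)%N by rewrite mul2n -addnn -addnA addn1.
  rewrite exprD expr1 ler_wpM2r ?(ltW de0) // exprD; apply: le_trans dM.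
  rewrite -[X in _ <= X]mul1r; apply: ler_pM; rewrite ?exprn_ge0 ?(ltW de0) //.
    by rewrite exprn_ile1 ?(ltW de0).
  by apply: lerXn2r; rewrite ?nnegrE ?(le_trans (ltW de0)) // ltW.
have p1 : 0 < 1 - p by rewrite subr_gt0.
have := le_trans kp (ler_wpM2l (ltW p1) dM').
move: (_ ^+ _) => z zle; have pd : 0 < p * delta by rewrite mulr_gt0.
by clear -zle pd; nra.
Qed.

Lemma failure_single p q delta : 0 < p <= q -> q <= 1 -> 0 < delta <= 1 ->
  (1 - q) ^+ (2 * Delta p delta).+1 < delta.
Proof.
move=> /andP[p0 pq] q1 /andP[de0 de1].
have [pE|p_neq1] := eqVneq p 1.
  have -> : q = 1 by apply/eqP; rewrite eq_le q1 -pE.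
  by rewrite subrr expr0n.
have p_lt1 : p < 1 by rewrite lt_neqAle p_neq1 (le_trans pq).
have px : (1 - p) ^+ Delta p delta <= delta.
  by apply: Delta_spec; rewrite ?p0 ?de0.
have := kill_power 1 (introT andP (conj p0 pq)) q1 p_lt1 px.
rewrite mul1n muln1 expr2 => /le_lt_trans; apply.
have dd : delta * delta <= delta by rewrite ler_piMr // ltW.
have p1 : 0 < 1 - p by rewrite subr_gt0.
apply: le_lt_trans (ler_wpM2l (ltW p1) dd) _.
by rewrite gtr_pMl // gtrBl.
Qed.

(** The union bound costs [k <= L + 3 <= 2 * (L + 1)]. With [x = delta / (L + 1)], one factor [x]
    cancels [L + 1] and leaves [delta]; the other satisfies [2 * x <= 1]. *)
Lemma failure_many p q delta (L : R) (k : nat) :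
  0 < p <= q -> q <= 1 -> 0 < delta <= 1 -> 1 <= L -> k%:R <= L + 3 ->
  k%:R * (1 - q) ^+ (2 * Delta p (delta / (L + 1))).+1 < delta.
Proof.
move=> /andP[p0 pq] q1 /andP[de0 de1] L1 kL; set x := delta / (L + 1).
have [pE|p_neq1] := eqVneq p 1.
  have -> : q = 1 by apply/eqP; rewrite eq_le q1 -pE.
  by rewrite subrr expr0n /= mulr0.
have p_lt1 : p < 1 by rewrite lt_neqAle p_neq1 (le_trans pq).
have L0 : 0 < L + 1 by lra.
have xL : x * (L + 1) = delta by rewrite /x mulfVK // gt_eqF.
have x0 : 0 < x by rewrite divr_gt0.
have x2 : 2 * x <= 1 by rewrite /x mulrA ler_pdivrMr // mul1r; clear -L1 de1; lra.
have px : (1 - p) ^+ Delta p x <= x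
  by apply: Delta_spec; [rewrite p0 | rewrite x0 /=; clear -x0 x2; lra].
have := kill_power 1 (introT andP (conj p0 pq)) q1 p_lt1 px.
rewrite mul1n muln1 expr2; move: (_ ^+ _.+1) => z zle.
have p1 : 0 < 1 - p by rewrite subr_gt0.
apply: (@le_lt_trans _ _ (k%:R * ((1 - p) * (x * x)))); first exact: ler_wpM2l.
apply: (@le_lt_trans _ _ (2 * (L + 1) * ((1 - p) * (x * x)))).
  have xx : 0 <= (1 - p) * (x * x) by rewrite mulr_ge0 ?(ltW p1) ?(ltW (mulr_gt0 x0 x0)).
  by apply: (ler_wpM2r xx); apply: le_trans kL _; clear -L1; lra.
have -> : 2 * (L + 1) * ((1 - p) * (x * x)) = (1 - p) * (2 * x) * delta.
  by rewrite -xL; ring.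
rewrite gtr_pMl //; apply: (@le_lt_trans _ _ (1 - p)); last by rewrite gtrBl.
by rewrite ler_piMr // ltW.
Qed.

Lemma log2_ge1 (r : nat) : (1 < r)%N -> 1 <= log2 (r%:R : R).
Proof.
move=> r1; rewrite /log2 ler_pdivlMr ?mul1r; last by apply: ln_gt0; rewrite ltr1n.
by rewrite ler_ln ?posrE ?ltr0n ?ler_nat // ltnW.
Qed.

End Bounds.

(** * Total moves and the choice of parameters *)

Section Solve.
Import Order.TTheory GRing.Theory Num.Theory.
Local Open Scope ring_scope.
Variables (R : realType) (T : finType) (e : rel T) (h v : T) (vs wl wr : seq T).
Hypothesis net : network e.
Hypothesis e_hv : e h v.
Hypothesis pair : traversal_pair e h v vs wl wr.

Let n := #|T|.
Let r := tp_radius e h vs.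
Let s := tp_size wl wr.
Let J := up_log 2 r.

Lemma s_gt0 : (0 < s)%N.
Proof.
have n1 := n_gt1 net e_hv pair.
have := index_wl_mono pair (ltnSn 0) n1; have := index_wl_lt pair (nth h vs 1).
by rewrite /s /tp_size /walk_length; lia.
Qed.

(** The union bound ranges over all [k] agents, or over a single one when [J = 0]; for [delta = 1] a
    positive chance of success is enough. *)
Lemma solves_search (nxt Fut rho : nat -> nat) (K : nat) (p delta B : R) (k : nat) :
  0 < p ->
  (forall j, (0 < j)%N -> (nxt j < j)%N) ->
  (forall j, (0 < j)%N -> (rho (nxt j) < rho j)%N) ->
  (forall j, (0 < j)%N -> (j <= J)%N ->
     (4 * r * 2 ^ (j - nxt j) + 2 * K * 2 ^ j + Fut (nxt j) <= Fut j)%N) ->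
  (rho J + 2 <= k)%N ->
  (3 * (4 * (2 * s + r) + 2 * K * n + Fut J) + k)%N%:R <= B ->
  delta = 1 \/ (forall q : R, p <= q <= 1 ->
    (if J == 0%N then 1%N else k)%:R * (1 - q) ^+ (2 * K).+1 < delta) ->
  exists P : protocol T, small_board P 10 /\ solves e h k P p delta B.
Proof.
move=> p0 nxt_lt rho_nxt Fut_nxt k_big B_big fail.
have nE := size_vs pair.
have [P [board_P main]] := search_protocol net e_hv pair
  (up_logP (p := 2) r isT) (up_log2_le r) nxt_lt rho_nxt Fut_nxt.
exists P; split=> // b q sch bh /andP[pq q1] fr.
have [mvs rep mort only] := main k b sch R q k_big bh fr.
have q01 : 0 < q <= 1 by rewrite (lt_le_trans p0 pq).
have k0 : (0 < k)%N by apply: leq_trans k_big; rewrite addn2.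
split.
- by move=> c _ t; apply: le_trans B_big; rewrite ler_nat /n -nE mvs.
- by move=> c pc; apply: rep.
move=> N _; case: fail => [->|/(_ q)]; last rewrite pq q1 => /(_ isT) fail.
  apply: coin_prob_lt1 => // wrong; apply: wrong; apply: mort => // i.
  by exists 0%N.
apply: le_lt_trans fail; case: eqP => [J0|_].
  have [i0 i0P] := only J0; rewrite -[X in X%:R * _](cards1 i0).
  apply: coin_prob_union => // c pc mi wrong; apply: wrong.
  by apply: i0P => //; have [j jK cj] := mi i0 (set11 i0); exists j.
rewrite -[k in k%:R]card_ord -cardsT; apply: coin_prob_union => // c pc mi wrong; apply: wrong.
by apply: mort => // i; have [j jK cj] := mi i (in_setT i); exists j.
Qed.

(** The coefficients 24 of [s], 12 of [r] and 24 of [r ^ 2], with the 3 agents, add up to 63; the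
    terms in [K * n] have coefficient [3 * (2 + 4) = 18]. *)
Lemma moves_one_level (K C D : nat) : K = (C * D)%N ->
  (3 * (4 * (2 * s + r) + 2 * K * n +
    (if J == 0 then 0 else 4 * r * 2 ^ J + 2 * K * 2 ^ J)) + 3
   <= (63 + 18 * C) * (s + D * n + r ^ 2))%N.
Proof.
move=> KE; have r0 := r_gt0 vs net e_hv; rewrite -/r in r0.
have rn : (r <= n)%N by rewrite /n -(size_vs pair) (r_le_n pair).
have J2 : (2 ^ J <= 2 * r)%N by apply: up_log2_double_bound.
have F_le : ((if J == 0 then 0 else 4 * r * 2 ^ J + 2 * K * 2 ^ J) <= 8 * r ^ 2 + 4 * (K * n))%N.
  case: ifP => // _; apply: leq_add.
    by apply: leq_trans (leq_mul (leqnn _) J2) _; rewrite -mulnn; lia.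
  apply: leq_trans (leq_mul (leqnn _) J2) _.
  by have := leq_mul (leqnn K) rn; lia.
have rr : (r <= r ^ 2)%N by rewrite -mulnn leq_pmulr.
have -> : ((63 + 18 * C) * (s + D * n + r ^ 2) =
   63 * s + 63 * (D * n) + 63 * r ^ 2 + 18 * (C * s) + 18 * (K * n) + 18 * (C * r ^ 2))%N.
  by rewrite KE -mulnA; lia.
move: F_le rr; rewrite -(mulnA 2).
set z := (if _ then _ else _); set r2 := (r ^ 2)%N; set kn := (K * n)%N.
by move: (D * n)%N (C * s)%N (C * r2)%N; lia.
Qed.

(** For [r = 1] the logarithm vanishes and [s] and [D * n] absorb everything. For larger [r] it is
    at least 1, so [J] is at most twice the logarithm. *)
Lemma moves_all_levels (D : nat) :
  ((3 * (4 * (2 * s + r) + 2 * D * n + (J * (8 * r) + 4 * D * 2 ^ J)) + (J + 2))%N%:R : R) <=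
  100%N%:R * ((s + D * n)%N%:R + r%:R * log2 (r%:R : R)).
Proof.
have r0 := r_gt0 vs net e_hv; rewrite -/r in r0.
have rn : (r <= n)%N by rewrite /n -(size_vs pair) (r_le_n pair).
have J2 : (2 ^ J <= 2 * r)%N by apply: up_log2_double_bound.
have s0 := s_gt0.
have DJ : (D * 2 ^ J <= 2 * (D * n))%N.
  by apply: leq_trans (leq_mul (leqnn D) J2) _; have := leq_mul (leqnn D) rn; lia.
have /andP[lo hi] := @log2_up_log R r r0; rewrite -/J in lo hi.
have [r1|r1] := leqP r 1%N.
  have rE : r = 1%N by lia.
  have JE : J = 0%N by rewrite /J rE up_log1.
  apply: (@le_trans _ _ (100 * (s + D * n))%N%:R).
    by rewrite ler_nat; move: DJ; rewrite JE rE -!mulnA; lia.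
  by rewrite natrM ler_pM2l ?ltr0n // lerDl rE /log2 ln1 mul0r mulr0.
have L1 := log2_ge1 R r1.
have rL : r%:R <= r%:R * log2 (r%:R : R) by rewrite ler_peMr.
have rJ : r%:R * J%:R <= 2 * (r%:R * log2 (r%:R : R)).
  rewrite mulrCA ler_wpM2l //; lra.
have J_le : J%:R <= r%:R * J%:R :> R by rewrite -natrM ler_nat leq_pmull.
have r1R : 1 <= r%:R :> R by rewrite ler1n.
have {}DJ : D%:R * (2 ^ J)%N%:R <= 2 * (D%:R * n%:R) :> R by rewrite -!natrM ler_nat.
have Dn : 0 <= D%:R * n%:R :> R by rewrite -natrM.
have sR : 0 <= s%:R :> R by [].
rewrite !(natrD, natrM).
lra.
Qed.

End Solve.

Import Order.TTheory GRing.Theory Num.Theory.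
Local Open Scope ring_scope.

(* In part (1) the constant c of the O-notation is chosen after a bound d0 < 1
   for delta, but uniformly in delta <= d0; as d0 is arbitrary and delta = 1 is
   always allowed, this covers every 0 < delta <= 1. *)
Theorem theorem4 (R : realType) :
  (exists k cw : nat, (0 < k)%N /\
   forall d0 : R, d0 < 1 ->
   exists c : nat,
   forall (delta p : R) (T : finType) (e : rel T) (h v : T) (vs wl wr : seq T),
     0 < delta <= 1 -> delta <= d0 \/ delta = 1 ->
     0 < p <= 1 ->
     network e -> e h v -> traversal_pair e h v vs wl wr ->
     light_steps e h vs wl wr ->
     let n := #|T| in
     let s := tp_size wl wr in
     let r := tp_radius e h vs in
     exists P : protocol T, small_board P cw /\
       solves e h k P p delta
         (c%:R * (s + Delta p delta * n + r ^ 2)%N%:R)) /\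
  (exists cw c : nat,
   forall (delta p : R) (T : finType) (e : rel T) (h v : T) (vs wl wr : seq T),
     0 < delta <= 1 ->
     0 < p <= 1 ->
     network e -> e h v -> traversal_pair e h v vs wl wr ->
     light_steps e h vs wl wr ->
     let n := #|T| in
     let s := tp_size wl wr in
     let r := tp_radius e h vs in
     let logr := log2 (r%:R : R) in
     exists P : protocol T, small_board P cw /\
       solves e h (nat_ceil (logr + 2)) P p delta
         (c%:R * ((s + Delta p (delta / (logr + 1)) * n)%N%:R + r%:R * logr))).
split.
- exists 3%N, 10%N; split=> // d0 d0_lt1.
  (* The maximum with [1 / 2] makes [d] positive, so that [Delta_spec] applies to [1 - d]. *)
  pose d := Num.max d0 (1 / 2).
  have d_lt1 : d < 1 by rewrite gt_max d0_lt1; lra.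
  have d_gt0 : 0 < d by rewrite lt_max; apply/orP; right; lra.
  pose M := Delta (1 - d) (1 / 3 : R).
  have dM : d ^+ M <= 1 / 3.
    have := @Delta_spec R (1 - d) (1 / 3); rewrite subKr; apply; lra.
  exists (63 + 18 * M.+1)%N => delta p T e h v vs wl wr /andP[de0 de1] de_d0 /andP[p0 p1]
    net e_hv pair _ n s r.
  pose K := (M.+1 * Delta p delta)%N.
  (* A reclaim leads from the top level straight to single nodes, so at most one agent is lost to it
     and three suffice. *)
  apply: (solves_search net e_hv pair (nxt := fun _ => 0%N) (rho := fun j => (0 < j)%N)
    (Fut := fun j => if j == 0%N then 0%N else
      (4 * r * 2 ^ up_log 2 r + 2 * K * 2 ^ up_log 2 r)%N) (K := K)) => //.
  + by case.
  + move=> [//|j] _ jJ; rewrite subn0 /= addn0.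
    by apply: leq_add; rewrite leq_mul2l leq_exp2l // jJ orbT.
  + by case: ltnP.
  + by rewrite -natrM ler_nat; apply: (moves_one_level net e_hv pair).
  case: de_d0 => [de_d0|]; [right | by left].
  move=> q /andP[pq q1]; apply: le_lt_trans (_ : 3 * (1 - q) ^+ (2 * K).+1 < delta).
    by rewrite ler_wpM2r ?exprn_ge0 ?subr_ge0 //; case: ifP => // _; rewrite ler1n.
  by apply: failure_reused q1 _ _ dM; rewrite ?p0 ?de0 // /d le_max de_d0.
exists 10%N, 100%N => delta p T e h v vs wl wr /andP[de0 de1] /andP[p0 p1]
  net e_hv pair _ n s r logr.
have r0 := r_gt0 vs net e_hv; rewrite -/r in r0.
have kE : nat_ceil (logr + 2) = (up_log 2 r + 2)%N by apply: nat_ceil_log2.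
rewrite kE; pose K := Delta p (delta / (logr + 1)).
(* Each halving costs [8 * r] for at most two chunks, and the terms [2 * K * 2 ^ j] form a geometric
   series bounded by [4 * K * 2 ^ j]. *)
apply: (solves_search net e_hv pair (nxt := predn) (rho := id)
  (Fut := fun j => (j * (8 * r) + 4 * K * 2 ^ j)%N) (K := K)) => //.
- by case.
- by case.
- move=> [//|j] _ _; rewrite /= subSn // subnn expn1 !expnS; lia.
- exact: (moves_all_levels R net e_hv pair).
right=> q /andP[pq q1]; rewrite -/r; case: eqP => [J0|/eqP J0].
  (* [J = 0] forces [r = 1], so the argument of [Delta] reduces to [delta] itself. *)
  rewrite mul1r /K; have -> : logr = 0.
    move/eqP: J0; rewrite up_log_eq0 /= => r1.
    have r_eq1 : r = 1%N by lia.
    by rewrite /logr r_eq1 /log2 ln1 mul0r.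
  by rewrite add0r divr1; apply: failure_single; rewrite ?p0 ?de0.
have r1 : (1 < r)%N by rewrite ltnNge; apply/negP => r1; move: J0; rewrite up_log_eq0 r1 orbT.
apply: failure_many; rewrite ?p0 ?de0 // ?log2_ge1 //.
have /andP[lo _] := @log2_up_log R r r0.
move: lo; rewrite -/logr ltrBlDr => /ltW lo; rewrite natrD.
by apply: le_trans (lerD lo (lexx _)) _; rewrite -addrA -[1]/(1%:R) -natrD.
Qed.
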